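(* Let $G\subset\mathbb C^n$ be a bounded balanced convex domain containing the origin. For a unit vector $v\in\mathbb C^n$, put $\Lambda=\mathbb Cv$ and let $r_\Lambda>0$ be determined by $$G\cap\Lambda=\{\zeta v:\zeta\in\mathbb C,\ |\zeta|<r_\Lambda\}.$$ Then, for every $p\in G\cap\Lambda$, $$M_G(p,\Lambda)=\frac{r_\Lambda^2-|p|^2}{r_\Lambda}.$$ Moreover, the Möbius parametrization of $G\cap\Lambda$ through $p$ is a directional extremal harmonic disk for $(G,p,\Lambda)$.
   Context: $\mathbb C^n$ is regarded as a real Hilbert space with inner product $\langle z,w\rangle=\operatorname{Re}\sum_j z_j\overline{w_j}$. $G$ is balanced if $\zeta z\in G$ whenever $z\in G$, $\zeta\in\mathbb C$, $|\zeta|\le1$. $\mathbb D$ is the open unit disk. A $C^2$ map $F:\mathbb D\to\mathbb C^n$ is harmonic if $\Delta F=0$. $\|dF_0\|$ is the operator norm of the real differential at $0$; a nonzero $dF_0:\mathbb R^2\to\mathbb C^n$ is conformal if $|dF_0u|=\lambda|u|$ for all $u\in\mathbb R^2$, for some $\lambda>0$. $\mathcal F_G(p,\Lambda)$ is the set of harmonic maps $F:\mathbb D\to G$ with $F(0)=p$, $dF_0\ne0$ conformal and $dF_0(\mathbb R^2)=\Lambda$; $M_G(p,\Lambda)=\sup\{\|dF_0\|:F\in\mathcal F_G(p,\Lambda)\}$. A member of $\mathcal F_G(p,\Lambda)$ attaining this supremum is a directional extremal harmonic disk for $(G,p,\Lambda)$. The Möbius parametrization of $G\cap\Lambda$ through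 $p$ is $T(z)=r_\Lambda\frac{s+z}{1+sz}\,e_1$, $z\in\mathbb D$, where $s=|p|/r_\Lambda$ and $e_1\in\Lambda$ is a unit vector with $p=|p|e_1$ ($e_1$ arbitrary in $\Lambda$ if $p=0$). *)

(* Defs.v *)
From HB Require Import structures.
From mathcomp Require Import all_boot all_order all_algebra.
From mathcomp Require Import complex.
From mathcomp Require Import all_classical all_reals all_analysis.
Set Implicit Arguments.
Unset Strict Implicit.
Unset Printing Implicit Defensive.
Import Order.TTheory GRing.Theory Num.Theory.
Import numFieldNormedType.Exports.

Local Open Scope complex_scope.
Local Open Scope classical_set_scope.
Local Open Scope ring_scope.

(* The cast to numClosedFieldType is what gives R[i], and hence row vectors
   over it, the topology and the normed-module structure over R[i]. *)
Notation Cplx R := (R[i] : numClosedFieldType).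
Notation Cvec R n := 'rV[Cplx R]_n.

Section ComplexSpace.
Variables (R : realType) (n : nat).
Implicit Types (z w v : Cvec R n) (G : set (Cvec R n)).

Definition cdot z w : R :=
  complex.Re (\sum_(j < n) z ord0 j * ((w ord0 j)^*)%C : R[i]).

(* The norm `|z| of the library on row vectors is the supremum norm. *)
Definition cnorm z : R := Num.sqrt (cdot z z).

Definition domain G : Prop := [/\ open G, connected G & G !=set0].

Definition balanced G : Prop :=
  forall (c : Cplx R) z, `|c| <= 1 -> G z -> G (c *: z).

Definition complex_line v : set (Cvec R n) := [set c *: v | c in [set: Cplx R]].

(* The identification of C^n, as a real space, with R^(2n), and its inverse. *)
Definition realify z : 'rV[R]_(n + n) :=
  row_mx (map_mx (@complex.Re R) z) (map_mx (@complex.Im R) z).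

Definition unrealify (x : 'rV[R]_(n + n)) : Cvec R n :=
  \row_j (lsubmx x ord0 j +i* rsubmx x ord0 j).

End ComplexSpace.

Definition enorm (R : realType) (m : nat) (x : 'rV[R]_m) : R :=
  Num.sqrt (\sum_(j < m) x ord0 j ^+ 2).

Section C2Maps.
Variables (R : realType) (k m : nat).
Implicit Types (A : set 'rV[R]_k) (f : 'rV[R]_k -> 'rV[R]_m).

Definition partial (i : 'I_k) f : 'rV[R]_k -> 'rV[R]_m :=
  'D_(delta_mx ord0 i) f.

Definition C1_on A f : Prop :=
  forall x, A x ->
    differentiable f x /\ forall i, {for x, continuous (partial i f)}.

Definition C2_on A f : Prop := C1_on A f /\ forall i, C1_on A (partial i f).

Definition laplacian f : 'rV[R]_k -> 'rV[R]_m :=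
  fun x => \sum_(i < k) partial i (partial i f) x.

End C2Maps.

Section HarmonicDisks.
Variables (R : realType) (n : nat).
Implicit Types (F : Cplx R -> Cvec R n) (L : 'rV[R]_2 -> Cvec R n).
Implicit Types (G Lam : set (Cvec R n)) (p : Cvec R n).

Definition unit_disk : set (Cplx R) := [set z | `|z| < 1].

(* A map F : D -> C^n is represented by a total map on C, of which only the
   restriction to the unit disk matters. *)
Definition of_plane (u : 'rV[R]_2) : Cplx R := u ord0 ord0 +i* u ord0 ord_max.

Definition real_form F : 'rV[R]_2 -> 'rV[R]_(n + n) :=
  fun u => realify (F (of_plane u)).

Definition harmonic_map F : Prop :=
  C2_on (of_plane @^-1` unit_disk) (real_form F) /\
  forall u, unit_disk (of_plane u) -> laplacian (real_form F) u = 0.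

Definition dF0 F : 'rV[R]_2 -> Cvec R n :=
  fun u => unrealify ('d (real_form F) 0 u).

Definition opnorm L : R := sup [set cnorm (L u) | u in [set u | enorm u <= 1]].

Definition conformal L : Prop :=
  exists2 lam : R, 0 < lam & forall u, cnorm (L u) = lam * enorm u.

Definition harmonic_disks G p Lam : set (Cplx R -> Cvec R n) :=
  [set F | [/\ harmonic_map F, forall z, unit_disk z -> G (F z) & F 0 = p] /\
           [/\ dF0 F <> (fun=> 0), conformal (dF0 F) & range (dF0 F) = Lam]].

(* An extended real, so that neither an empty nor an unbounded family gets a
   junk value. *)
Definition maximal_stretch G p Lam : \bar R :=
  ereal_sup [set (opnorm (dF0 F))%:E | F in harmonic_disks G p Lam].

Definition directional_extremal G p Lam F : Prop :=
  harmonic_disks G p Lam F /\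
  (opnorm (dF0 F))%:E = maximal_stretch G p Lam.

Definition mobius_disk (r s : R) (e : Cvec R n) : Cplx R -> Cvec R n :=
  fun z => (r%:C * (s%:C + z) / (1 + s%:C * z)) *: e.

End HarmonicDisks.

(* Main.v *)
Require Import Defs.
From HB Require Import structures.
From mathcomp Require Import all_boot all_order all_algebra.
From mathcomp Require Import complex.
From mathcomp Require Import all_classical all_reals all_analysis.
From mathcomp Require Import ring lra zify.
Import Order.TTheory GRing.Theory Num.Theory.
Import numFieldNormedType.Exports.
Set Implicit Arguments.
Unset Strict Implicit.
Unset Printing Implicit Defensive.
Local Open Scope complex_scope.
Local Open Scope classical_set_scope.
Local Open Scope ring_scope.
Local Notation normc := ComplexField.Normc.normc.
Local Notation normcM := ComplexField.Normc.normcM.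
Local Notation normcV := ComplexField.Normc.normcV.
Local Notation normc0 := ComplexField.Normc.normc0.
Local Notation normc1 := ComplexField.Normc.normc1.

(** Upper bound.  Since [r v] is not in the convex balanced open set [G], for
every [q > r] the point [q v] is separated from [G] by a complex linear
functional [l] with [|l| <= 1] on [G] and [l (q v) = 1] ([separation]).  If [F]
is an admissible disk then [h = l o F] is a complex valued harmonic function
with [|h| <= 1], and because [dF_0] is conformal with image [C v] the
differential of [h] at [0] is either [z |-> b z] or [z |-> b z^*], with
[|b| = ||dF_0|| / q] ([conformal_dichotomy]).  For such an [h] the Schwarz-Pick
inequality [|b| <= 1 - |h 0|^2] holds ([schwarz_pick]), that is
[||dF_0|| <= (q^2 - |p|^2) / q]; it remains to let [q] tend to [r].

Schwarz-Pick at a conformal point.  Write [a = h 0] and normalise [b >= 0].  On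
the unit circle [P(w) = 2 a^* + a^*^2 w + w^*] equals [w^* (1 + a^* w)^2], so
that [|P(w)| = |1 + a^* w|^2] has mean value [1 + |a|^2].  Testing [h] against
[P] on the circle only sees the Fourier coefficients [a], [b] and [0] of [h] at
the frequencies [0], [1] and [-1]; in the limit of the radius [1] this gives
[2 |a|^2 + b <= 1 + |a|^2].

Fourier coefficients without integrals.  The circle is replaced by the [N]-th
roots of unity.  Removing [a + b z] from [h] leaves a harmonic [g = o(z)], and
one has to see that the discrete Fourier coefficients of [g] at the frequencies
[0], [1], [-1] on the circle of radius [rho] are small ([circle_mode_vanish]).
The corresponding average [M] of the rotated copies of [g] is harmonic, and it
transforms like [1], [z] or [z^*] under a rotation by a root of unity, hence up
to a small error under any rotation when the roots are dense.  By the maximum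
principle [M] is then close to a multiple of [1], [z] or [z^*] on the
whole disk of radius [rho], and [g = o(z)] makes this multiple small.

The maximum principle needs little: a function whose second differences along
every orthogonal cross are [o(t^2)] satisfies it, and this form of harmonicity
is visibly stable under the rotations and sums above ([weakly_harmonic]).  For
a [C^2] map with vanishing Laplacian it follows from the mean value theorem on
lines ([second_difference]).

Equality.  The Moebius disk is holomorphic, so it is harmonic and conformal at
[0], its values lie in the intersection of [G] and [C v] because
[|1 + s z|^2 - |s + z|^2 = (1 - s^2) (1 - |z|^2)], and its derivative at [0] has
modulus [r (1 - s^2) = (r^2 - |p|^2) / r] ([mobius_admissible]). *)

(** * Moduli of complex numbers *)

Section Normc.
Variable R : rcfType.
Implicit Types z w : R[i].

Lemma normc_ge0 z : 0 <= normc z.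
Proof. by case: z => a b; exact: sqrtr_ge0. Qed.

Lemma normc_sqr z : normc z ^+ 2 = complex.Re z ^+ 2 + complex.Im z ^+ 2.
Proof. by case: z => a b /=; rewrite sqr_sqrtr // addr_ge0 ?sqr_ge0. Qed.

Lemma norm_normc z : `|z| = (normc z)%:C.
Proof. by rewrite normc_def; case: z. Qed.

Lemma normc_real (x : R) : normc x%:C = `|x|.
Proof. by rewrite /= expr0n addr0 sqrtr_sqr. Qed.

Lemma normc_conj z : normc z^* = normc z.
Proof. by case: z => a b /=; rewrite sqrrN. Qed.

Lemma conjcD z w : (z + w)^* = z^* + w^* :> R[i].
Proof.
case: z w => a b [c d]; apply/eqP; rewrite eq_complex /=.
by apply/andP; split; apply/eqP; ring.
Qed.

Lemma conjcN z : (- z)^* = - z^* :> R[i].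
Proof. by case: z. Qed.

Lemma conjcB z w : (z - w)^* = z^* - w^* :> R[i].
Proof. by rewrite conjcD conjcN. Qed.

Lemma conjcM z w : (z * w)^* = z^* * w^* :> R[i].
Proof.
case: z w => a b [c d]; apply/eqP; rewrite eq_complex /=.
by apply/andP; split; apply/eqP; ring.
Qed.

Lemma ofrealD (x y : R) : (x + y)%:C = x%:C + y%:C :> R[i].
Proof. exact: rmorphD. Qed.

Lemma ofrealM (x y : R) : (x * y)%:C = x%:C * y%:C :> R[i].
Proof. exact: rmorphM. Qed.

Lemma ofreal_nat n : (n%:R : R)%:C = n%:R :> R[i].
Proof. exact: rmorph_nat. Qed.

Lemma conjc_invol z : z^*^* = z.
Proof. exact: conjcK. Qed.

Lemma conjc_ofreal (x : R) : (x%:C : R[i])^* = x%:C.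
Proof. exact: conjc_real. Qed.

Lemma conjc_zero : (0 : R[i])^* = 0.
Proof. exact: conjc_ofreal. Qed.

Lemma conjc_one : (1 : R[i])^* = 1.
Proof. exact: conjc_ofreal. Qed.

Lemma mulc_conj z : z * z^* = ((normc z) ^+ 2)%:C.
Proof.
rewrite normc_sqr; case: z => a b /=.
by apply/eqP; rewrite eq_complex /=; apply/andP; split; apply/eqP; ring.
Qed.

Lemma Re_le_normc z : complex.Re z <= normc z.
Proof.
have [r0|r0] := leP (complex.Re z) 0; first exact: (le_trans r0 (normc_ge0 _)).
rewrite -(@ler_pXn2r _ 2) ?nnegrE ?normc_ge0 ?(ltW r0) //.
by rewrite normc_sqr lerDl sqr_ge0.
Qed.

Lemma ImRe_i z : complex.Im z = complex.Re (- 'i * z).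
Proof. by case: z => a b /=; ring. Qed.

Lemma normc_i : normc ('i : R[i]) = 1.
Proof. by rewrite /= expr0n add0r expr1n sqrtr1. Qed.

Lemma normcN z : normc (- z) = normc z.
Proof. by case: z => a b /=; rewrite !sqrrN. Qed.

Lemma abs_Re_le_normc z : `|complex.Re z| <= normc z.
Proof.
rewrite ler_norml Re_le_normc andbT -normcN lerNl.
by apply: le_trans (Re_le_normc _); case: z.
Qed.

Lemma abs_Im_le_normc z : `|complex.Im z| <= normc z.
Proof.
rewrite ImRe_i; apply: le_trans (abs_Re_le_normc _) _.
by rewrite normcM normcN normc_i mul1r.
Qed.

Lemma normc_le_ReIm z : normc z <= `|complex.Re z| + `|complex.Im z|.
Proof.
rewrite [z in normc z]complexE; apply: le_trans (le_normcD _ _) _.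
by rewrite normcM normc_i mul1r !normc_real.
Qed.

Lemma normc_distC z w : normc (z - w) = normc (w - z).
Proof. by rewrite -normcN opprB. Qed.

Lemma normc_sum (I : Type) (r : seq I) (P : pred I) (F : I -> R[i]) :
  normc (\sum_(i <- r | P i) F i) <= \sum_(i <- r | P i) normc (F i).
Proof.
apply: (big_ind2 (fun x y => normc x <= y)) => //.
  by rewrite normc0.
by move=> x1 x2 y1 y2 h1 h2; apply: le_trans (le_normcD _ _) _; exact: lerD.
Qed.

Lemma normc_eq0 z : (normc z == 0) = (z == 0).
Proof.
apply/eqP/eqP; first exact: ComplexField.Normc.eq0_normc.
by move=> ->; exact: normc0.
Qed.

Lemma normc_gt0 z : (0 < normc z) = (z != 0).
Proof. by rewrite lt_neqAle eq_sym normc_eq0 normc_ge0 andbT. Qed.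

Lemma normcX z n : normc (z ^+ n) = normc z ^+ n.
Proof.
elim: n => [|n IH]; first by rewrite !expr0 normc1.
by rewrite !exprS normcM IH.
Qed.

Lemma eq_normc_unit z : z != 0 ->
  exists2 u, normc u = 1 & u * z = (normc z)%:C.
Proof.
move=> z0; have n0 : normc z != 0 by rewrite normc_eq0.
have nC : (normc z)%:C != 0 :> R[i] by rewrite eq_complex /= negb_and n0.
exists (z^* / (normc z)%:C).
  rewrite normcM normcV normc_conj.
  by rewrite normc_real ger0_norm ?normc_ge0 // divff.
by rewrite mulrAC [_ * z]mulrC mulc_conj expr2 rmorphM -mulrA divff// mulr1.
Qed.
End Normc.

(** * Finite groups dense in the unit circle *)

Section RootsOfUnity.
Variable R : realType.

Definition expi (t : R) : R[i] := cos t +i* sin t.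

Lemma expiD s t : expi (s + t) = expi s * expi t.
Proof.
rewrite /expi cosD sinD; apply/eqP; rewrite eq_complex /=.
by apply/andP; split; apply/eqP; ring.
Qed.

Lemma expiX t n : expi t ^+ n = expi (t *+ n).
Proof.
elim: n => [|n IH]; first by rewrite expr0 mulr0n /expi cos0 sin0.
by rewrite exprS IH mulrS expiD.
Qed.

Lemma normc_expi t : normc (expi t) = 1.
Proof. by rewrite /= cos2Dsin2 sqrtr1. Qed.

Lemma expi_surj z : normc z = 1 -> exists2 t, 0 <= t <= pi *+ 2 & z = expi t.
Proof.
case: z => a b; move=> h; have := normc_sqr (a +i* b); rewrite h expr1n /= => h1.
have a1 : -1 <= a <= 1.
  rewrite -ler_norml -(@ler_pXn2r _ 2) ?nnegrE // expr1n real_normK ?num_real //.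
  by rewrite h1 lerDl sqr_ge0.
have [ac0 acK] := acos_def a1.
have sE : sin (acos a) = `|b|.
  rewrite sin_acos // h1 addrC addKr sqrtr_sqr //.
have [b0|b0] := leP 0 b.
  exists (acos a); last by rewrite /expi acK sE ger0_norm.
  case/andP: ac0 => -> /= h2; apply: le_trans h2 _; rewrite mulr2n lerDl; exact: pi_ge0.
exists (pi *+ 2 - acos a).
  have := pi_ge0 R; case/andP: ac0; rewrite mulr2n; lra.
rewrite /expi cosB sinB !(cos2pi,
  sin2pi) acK sE ltr0_norm // !mul0r addr0 sub0r !mul1r opprK.
by [].
Qed.

(** The condition [w ^+ 2 != 1] excludes the groups of order at most two, on which
the frequencies [1] and [-1] could not be told apart. *)
Lemma dense_roots (d : R) : 0 < d -> exists N w,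
  [/\ (0 < N)%N, w ^+ N = 1, normc w = 1, w ^+ 2 != 1 &
   forall z, normc z = 1 -> exists k, normc (z - w ^+ k) < d].
Proof.
move=> d0.
have cts0 : \forall t \near (0 : R), normc (expi t - 1) < d.
  have d2 : 0 < d / 2 by rewrite divr_gt0.
  have /cvgrPdist_lt /(_ _ d2) c0 := @continuous_cos R 0.
  have /cvgrPdist_lt /(_ _ d2) s0 := @continuous_sin R 0.
  near=> t; apply: le_lt_trans (normc_le_ReIm _) _; rewrite /= subr0.
  rewrite (splitr d) ltrD //.
    by rewrite distrC -{1}(@cos0 R); near: t.
  by rewrite -normrN -sub0r -(@sin0 R); near: t.
have [e /= e0 he] := cts0.
have pi0 := pi_gt0 R.
(* The offset [3] puts the angle [2 pi / N] below [pi], where [sin] is positive. *)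
pose N := (Num.truncn (pi *+ 2 / e)).+3.
have N0 : 0 < N%:R :> R by rewrite ltr0n.
have hN : pi *+ 2 / N%:R < e.
  rewrite ltr_pdivrMr // mulrC -ltr_pdivrMr //.
  have := truncn_itv (ltW (divr_gt0 (mulrn_wgt0 2 pi0) e0)).
  case/andP=> _ h; apply: lt_le_trans h _.
  by rewrite ler_nat /N !ltnS leqW.
exists N, (expi (pi *+ 2 / N%:R)); split => //.
- rewrite expiX -[(_ / _) *+ _]mulr_natr divfK ?gt_eqF // /expi cos2pi sin2pi //.
- exact: normc_expi.
- rewrite sqrf_eq1 negb_or !eq_complex /= oppr0.
  suff: 0 < sin (pi *+ 2 / N%:R :> R) by move=> /gt_eqF ->; rewrite !andbF.
  apply: sin_gt0_pi; apply/andP; split; first by rewrite divr_gt0 // mulrn_wgt0.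
  by rewrite ltr_pdivrMr // -[pi *+ 2]mulr_natr ltr_pM2l // ltr_nat.
move=> z /expi_surj [t /andP[t0 t1] ->].
pose a := pi *+ 2 / N%:R : R.
have a0 : 0 < a by rewrite divr_gt0 // mulrn_wgt0.
exists (Num.truncn (t / a)).
rewrite expiX -/a -[X in expi X](subrK (a *+ Num.truncn (t / a))) expiD.
rewrite -{2}[expi (a *+ _)]mul1r -mulrBl normcM normc_expi mulr1.
apply: he => /=; rewrite sub0r normrN.
have /andP[h1 h2] := truncn_itv (divr_ge0 t0 (ltW a0)).
rewrite -[a *+ _]mulr_natr ger0_norm; last by rewrite subr_ge0 mulrC -ler_pdivlMr.
rewrite ltr_pdivrMr // -natr1 mulrDl mul1r mulrC in h2.
by apply: lt_trans hN; rewrite -/a; lra.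
Unshelve. all: by end_near. Qed.
End RootsOfUnity.

(** * Harmonicity by second differences *)

Section WeaklyHarmonic.
Variable R : realType.
Implicit Types (g h : R[i] -> R[i]) (z w u v : R[i]).

Definition cts_at g z := forall e : R, 0 < e ->
  exists2 d : R, 0 < d & forall w, normc (w - z) < d -> normc (g w - g z) < e.

(** The standard five-point approximation of [|v|^2] times the Laplacian, on the
cross with arms [v] and ['i * v]. *)
Definition cross_laplacian g z v :=
  g (z + v) + g (z - v) + g (z + 'i * v) + g (z - 'i * v) - 4 * g z.

(** Quantifying over all directions [u] makes this notion invariant under
rotations of the plane. *)
Definition flat_at g z := forall u (e : R), 0 < e ->
  exists2 d : R, 0 < d &
    forall t : R, 0 < t -> t < d -> normc (cross_laplacian g z (t%:C * u)) <= e * t ^+ 2.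

Definition weakly_harmonic g := forall z, normc z < 1 -> cts_at g z /\ flat_at g z.

Lemma weakly_harmonic_add g h : weakly_harmonic g -> weakly_harmonic h ->
  weakly_harmonic (fun z => g z + h z).
Proof.
move=> hg hh z z1; have [cg fg] := hg z z1; have [ch fh] := hh z z1.
split.
  move=> e e0; have e2 : 0 < e / 2 by lra.
  have [d1 d10 h1] := cg _ e2; have [d2 d20 h2] := ch _ e2.
  exists (Num.min d1 d2); first by rewrite lt_min d10.
  move=> w; rewrite lt_min => /andP[w1 w2].
  rewrite opprD addrACA (splitr e).
  by apply: le_lt_trans (le_normcD _ _) _; rewrite ltrD ?h1 ?h2.
move=> u e e0; have e2 : 0 < e / 2 by lra.
have [d1 d10 h1] := fg u _ e2; have [d2 d20 h2] := fh u _ e2.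
exists (Num.min d1 d2); first by rewrite lt_min d10.
move=> t t0; rewrite lt_min => /andP[w1 w2].
have -> : cross_laplacian (fun z => g z + h z) z (t%:C * u) =
  cross_laplacian g z (t%:C * u) + cross_laplacian h z (t%:C * u).
  by rewrite /cross_laplacian; ring.
by apply: le_trans (le_normcD _ _) _; rewrite (splitr e) mulrDl lerD ?h1 ?h2.
Qed.

Lemma weakly_harmonic_cst c : weakly_harmonic (fun=> c).
Proof.
move=> z _; split.
  by move=> e e0; exists 1 => // w _; rewrite subrr normc0.
move=> u e e0; exists 1 => // t t0 _.
have -> : cross_laplacian (fun=> c) z (t%:C * u) = 0 by rewrite /cross_laplacian; ring.
by rewrite normc0 mulr_ge0 ?sqr_ge0 // ltW.
Qed.

Lemma weakly_harmonic_id : weakly_harmonic id.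
Proof.
move=> z _; split; first by move=> e e0; exists e.
move=> u e e0; exists 1 => // t t0 _.
have -> : cross_laplacian id z (t%:C * u) = 0 by rewrite /cross_laplacian; ring.
by rewrite normc0 mulr_ge0 ?sqr_ge0 // ltW.
Qed.

Lemma weakly_harmonic_scale c g : weakly_harmonic g -> weakly_harmonic (fun z => c * g z).
Proof.
move=> hg; have [->|c0] := eqVneq c 0.
  have -> : (fun z => 0 * g z) = (fun=> 0) by apply/funext => z; rewrite mul0r.
  exact: weakly_harmonic_cst.
move=> z z1; have [cg fg] := hg z z1.
have n0 : 0 < normc c by rewrite normc_gt0.
split.
  move=> e e0; have [d d0 hd] := cg _ (divr_gt0 e0 n0); exists d => // w /hd.
  by rewrite -mulrBr normcM ltr_pdivlMr // mulrC.
move=> u e e0; have [d d0 hd] := fg u _ (divr_gt0 e0 n0); exists d => // t t0 td.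
have -> : cross_laplacian (fun z => c * g z) z (t%:C * u) = c *
  cross_laplacian g z (t%:C * u).
  by rewrite /cross_laplacian; ring.
rewrite normcM mulrC -ler_pdivlMr //.
by apply: le_trans (hd _ t0 td) _; rewrite mulrAC.
Qed.

Lemma weakly_harmonic_rot w g : normc w = 1 -> weakly_harmonic g ->
  weakly_harmonic (fun z => g (w * z)).
Proof.
move=> w1 hg z z1.
have z1' : normc (w * z) < 1 by rewrite normcM w1 mul1r.
have [cg fg] := hg _ z1'; split.
  move=> e e0; have [d d0 hd] := cg _ e0; exists d => // x xd; apply: hd.
  by rewrite -mulrBr normcM w1 mul1r.
move=> u e e0; have [d d0 hd] := fg (w * u) _ e0; exists d => // t t0 td.
have -> : cross_laplacian (fun z => g (w * z)) z (t%:C * u) = cross_laplacian g (w *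
  z) (t%:C * (w * u)).
  rewrite /cross_laplacian; have -> : w * (z + t%:C * u) = w * z + t%:C * (w * u) by ring.
  have -> : w * (z - t%:C * u) = w * z - t%:C * (w * u) by ring.
  have -> : w * (z + 'i * (t%:C * u)) = w * z + 'i * (t%:C * (w * u)) by ring.
  by have -> : w * (z - 'i * (t%:C * u)) = w * z - 'i * (t%:C * (w * u)) by ring.
exact: hd.
Qed.

Lemma weakly_harmonic_conj g : weakly_harmonic g -> weakly_harmonic (fun z => g z^*).
Proof.
move=> hg z z1.
have z1' : normc z^* < 1 by rewrite normc_conj.
have [cg fg] := hg _ z1'; split.
  move=> e e0; have [d d0 hd] := cg _ e0; exists d => // x xd; apply: hd.
  by rewrite -conjcB normc_conj.
move=> u e e0; have [d d0 hd] := fg u^* _ e0; exists d => // t t0 td.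
have -> : cross_laplacian (fun z => g z^*) z (t%:C * u) =
  cross_laplacian g z^* (t%:C * u^*).
  have ci : ('i : R[i])^* = - 'i by apply/eqP; rewrite eq_complex /= oppr0 !eqxx.
  rewrite /cross_laplacian !(conjcD, conjcN, conjcM) ci conjc_ofreal.
  by rewrite !mulNr opprK; ring.
exact: hd.
Qed.

Lemma weakly_harmonic_sum (I : Type) (r : seq I) (F : I -> R[i] -> R[i]) :
  (forall i, weakly_harmonic (F i)) -> weakly_harmonic (fun z => \sum_(i <- r) F i z).
Proof.
move=> hF; elim: r => [|i r IH].
  have -> : (fun z => \sum_(i <- [::]) F i z) = (fun=> 0).
    by apply/funext => z; rewrite big_nil.
  exact: weakly_harmonic_cst.
have -> : (fun z => \sum_(j <- i :: r) F j z) =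
          (fun z => F i z + \sum_(j <- r) F j z).
  by apply/funext => z; rewrite big_cons.
exact: weakly_harmonic_add.
Qed.
End WeaklyHarmonic.

(** * Compactness of closed disks *)

Section Compactness.
Variable R : realType.
Implicit Types (g h : R[i] -> R[i]) (z w u v : R[i]).

(** The inverse of [of_plane]. *)
Definition plane z : 'rV[R]_2 :=
  \row_j (if j == ord0 then complex.Re z else complex.Im z).

Lemma planeK z : of_plane (plane z) = z.
Proof. by rewrite /of_plane !mxE; case: z. Qed.

Lemma of_planeK (x : 'rV[R]_2) : plane (of_plane x) = x.
Proof.
apply/rowP => j; rewrite mxE /=.
by case: j => [[|[|//]] hj] /=; congr (x _ _); apply/val_inj.
Qed.

Lemma of_planeB (x y : 'rV[R]_2) : of_plane x - of_plane y = of_plane (x - y) :> R[i].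
Proof. by apply/eqP; rewrite eq_complex /= !mxE !eqxx. Qed.

Lemma normr_coord m (x : 'rV[R]_m) j : `|x ord0 j| <= `|x|.
Proof.
rewrite [leRHS]/Num.norm /= mx_normrE; apply/bigmax_geP; right => /=.
by exists (ord0, j).
Qed.

Lemma normc_of_plane (x : 'rV[R]_2) : normc (of_plane x) <= 2 * `|x|.
Proof.
apply: le_trans (normc_le_ReIm _) _; rewrite /= mulr_natl mulr2n.
by apply: lerD; exact: normr_coord.
Qed.

Lemma norm_plane z : `|plane z| <= normc z.
Proof.
rewrite [leLHS]/Num.norm /= mx_normrE; apply/bigmax_leP; split=> /=.
  exact: normc_ge0.
move=> [i j] _ /=; rewrite mxE; case: ifP => _.
- exact: abs_Re_le_normc.
- exact: abs_Im_le_normc.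
Qed.

Lemma nbhs_rVP m (x : 'rV[R]_m) (P : set 'rV[R]_m) :
  nbhs x P <-> exists2 d : R, 0 < d & forall y, `|x - y| < d -> P y.
Proof.
split.
  move=> /nbhs_ballP[d /= d0 hd]; exists d => // y xy; apply: hd.
  by rewrite -ball_normE.
move=> [d d0 hd]; apply/nbhs_ballP; exists d => // y; rewrite -ball_normE.
exact: hd.
Qed.

Definition closed_disk (r : R) : set 'rV[R]_2 := [set x | normc (of_plane x) <= r].

Lemma normc_dist_dist z w : `|normc z - normc w| <= normc (z - w).
Proof.
rewrite ler_norml; apply/andP; split.
  rewrite lerBrDr addrC lerBlDr normc_distC.
  by apply: le_trans (le_normcD _ _); rewrite addrC subrK.
by rewrite lerBlDr; apply: le_trans (le_normcD _ _); rewrite subrK.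
Qed.

Lemma cts_real_plane (f : R[i] -> R) (x : 'rV[R]_2) :
  (forall e : R, 0 < e -> exists2 d : R, 0 < d &
     forall w, normc (w - of_plane x) < d -> `|f w - f (of_plane x)| < e) ->
  {for x, continuous (f \o @of_plane R)}.
Proof.
move=> hf P /nbhs_ballP[e /= e0 he]; have [d d0 hd] := hf e e0.
have d2 : 0 < d / 2 by lra.
apply/nbhs_rVP; exists (d / 2) => // y xy.
apply: he; rewrite -ball_normE /= distrC; apply: hd; rewrite of_planeB.
apply: le_lt_trans (normc_of_plane _) _; rewrite distrC; lra.
Qed.

Lemma compact_closed_disk (r : R) : compact (closed_disk r).
Proof.
apply: bounded_closed_compact.
  exists r; split; first exact: num_real.
  move=> M rM x /= xr; apply: le_trans (ltW rM).
  by apply: le_trans xr; rewrite -{1}(of_planeK x) norm_plane.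
have -> : closed_disk r = ((fun z => normc z) \o @of_plane R) @^-1` [set x : R | x <=
  r] by [].
apply: preimage_closed; last exact: closed_le.
move=> x _; apply: cts_real_plane => e e0; exists e => // w.
exact: le_lt_trans (normc_dist_dist _ _).
Qed.

(** Heine-Cantor.  The modulus of continuity is found through the covering form
of compactness, with the radius [t] as the parameter tending to [0]. *)
Lemma cts_at_uniform g (r : R) : (forall z, normc z <= r -> cts_at g z) ->
  forall e : R, 0 < e -> exists2 d : R, 0 < d &
    forall z w, normc z <= r -> normc (w - z) < d -> normc (g w - g z) < e.
Proof.
move=> cg e e0.
have /compact_near_coveringP cov := @compact_closed_disk r.
have := cov R (0^'+) (fun d x => forall w, normc (w - of_plane x) < d ->
   normc (g w - g (of_plane x)) < e).
case.
- move=> x xr; have e2 : 0 < e / 2 by lra.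
  have [d d0 hd] := cg _ xr _ e2; have d2 : 0 < d / 2 by lra.
  have d4 : 0 < d / 4 by lra.
  exists (ball x (d / 4), [set t | t < d / 2]).
    by split; [exact: nbhsx_ballx|exact: nbhs_right_lt].
  move=> [y t] [] /=; rewrite -ball_normE /= => xy td w wy.
  have yx : normc (of_plane y - of_plane x) < d / 2.
    rewrite of_planeB; apply: le_lt_trans (normc_of_plane _) _.
    rewrite distrC; lra.
  have -> : g w - g (of_plane y) = (g w - g (of_plane x)) - (g (of_plane y) -
    g (of_plane x)) by ring.
  apply: le_lt_trans (le_normcD _ _) _; rewrite normcN (splitr e) ltrD //; apply: hd.
    have -> : w - of_plane x = (w - of_plane y) + (of_plane y - of_plane x) by ring.
    apply: le_lt_trans (le_normcD _ _) _; lra.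
  lra.
- move=> d /= d0 hd; exists (d / 2); first by lra.
  move=> z w zr wz; have := hd (d / 2); rewrite /= sub0r normrN gtr0_norm; last by lra.
  have h1 : d / 2 < d by lra.
  have h2 : 0 < d / 2 by lra.
  move=> /(_ h1 h2 (plane z)); rewrite planeK; apply=> //.
  by rewrite /closed_disk /mkset planeK.
Qed.

End Compactness.

(** * The maximum principle *)

Section MaxPrinciple.
Variable R : realType.
Implicit Types (g h : R[i] -> R[i]) (z w u v : R[i]).

Lemma normc_sqr_cross z (t : R) :
  normc (z + t%:C) ^+ 2 + normc (z - t%:C) ^+ 2 + normc (z + 'i * t%:C) ^+ 2
   + normc (z - 'i * t%:C) ^+ 2 = 4 * normc z ^+ 2 + 4 * t ^+ 2.
Proof. by rewrite !normc_sqr; case: z => a b /=; ring. Qed.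

(** If [|g z0| > B], rotate the value [g z0] to the positive axis by a unit [u] and
perturb: [Re (u g z) + ep |z|^2] is still larger at [z0] than on the circle, so
it has an interior maximum.  There the cross sum of [Re (u g)] is at most
[- 4 ep t^2], whereas flatness makes it [o(t^2)]. *)
Lemma max_principle g (r B : R) : weakly_harmonic g -> 0 < r -> r < 1 ->
  (forall z, normc z = r -> normc (g z) <= B) ->
  forall z, normc z <= r -> normc (g z) <= B.
Proof.
move=> hg r0 r1 hB z0 z0r; rewrite leNgt; apply/negP => Bz0.
have B0 : 0 <= B.
  apply: le_trans (normc_ge0 (g r%:C)) (hB _ _).
  by rewrite normc_real gtr0_norm.
have [u u1 ug] : exists2 u, normc u = 1 & u * g z0 = (normc (g z0))%:C.
  by apply: eq_normc_unit; rewrite -normc_gt0; lra.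
have hug := weakly_harmonic_scale u hg.
pose ep := (normc (g z0) - B) / 2.
have ep0 : 0 < ep by rewrite /ep; lra.
pose f z := complex.Re (u * g z) + ep * normc z ^+ 2.
have [||m mr mmax] := @EVT_max_rV R 2 (fun x => f (of_plane x)) (closed_disk r) _
   (compact_closed_disk (r:=r)).
- by exists (plane z0); rewrite /closed_disk /mkset planeK.
- apply: continuous_in_subspaceT => x; rewrite inE => xr.
  have x1 : normc (of_plane x) < 1 by apply: le_lt_trans xr r1.
  have c1 : {for x, continuous ((fun z => complex.Re (u * g z)) \o @of_plane R)}.
    apply: cts_real_plane => e e0.
    have [cug _] := hug _ x1; have [d d0 hd] := cug _ e0; exists d => // w /hd.
    apply: le_lt_trans; apply: le_trans (abs_Re_le_normc _).
    by rewrite [X in _ <= `|X|]raddfB.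
  have cn : {for x, continuous ((fun z => normc z) \o @of_plane R)}.
    apply: cts_real_plane => e e0; exists e => // w.
    exact: le_lt_trans (normc_dist_dist _ _).
  exact: (cvgD c1 (cvgM (cvg_cst ep) (cvgM cn cn))).
have {}mr : normc (of_plane m) <= r by move: mr; rewrite inE.
have fle z : normc z <= r -> f z <= f (of_plane m).
  move=> zr; rewrite -(planeK z); apply: mmax; rewrite inE /closed_disk /mkset planeK //.
have fm : normc (g z0) <= f (of_plane m).
  apply: le_trans (fle _ z0r); rewrite /f ug /= lerDl.
  by rewrite mulr_ge0 ?sqr_ge0 // ltW.
set c := of_plane m in fle fm mr.
have cr : normc c < r.
  rewrite lt_neqAle mr andbT; apply/eqP => ceq.
  have : f c <= B + ep * 1.
    apply: lerD.
      by apply: le_trans (Re_le_normc _) _; rewrite normcM u1 mul1r; exact: hB.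
    rewrite ler_wpM2l ?(ltW ep0) // ceq; rewrite expr_le1 //; [exact: ltW|exact: ltW].
  rewrite /ep in fm ep0 *; lra.
have [_ fl] := hug c (lt_trans cr r1).
have [d d0 hd] := fl 1 ep ep0.
pose t := Num.min d (r - normc c) / 2.
have t0 : 0 < t by rewrite divr_gt0 // lt_min d0 subr_gt0.
have td : t < d.
  have : Num.min d (r - normc c) <= d by rewrite ge_min lexx.
  by rewrite /t in t0 *; lra.
have tc : normc c + t <= r.
  have : Num.min d (r - normc c) <= r - normc c by rewrite ge_min lexx orbT.
  by rewrite /t in t0 *; lra.
have nt : normc (t%:C : R[i]) = t by rewrite normc_real gtr0_norm.
have near v : normc v = t -> f (c + v) <= f c.
  by move=> nv; apply: fle; apply: le_trans (le_normcD _ _) _; rewrite nv.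
have h1 := near _ nt.
have h2 : f (c - t%:C) <= f c by apply: near; rewrite normcN.
have h3 : f (c + 'i * t%:C) <= f c by apply: near; rewrite normcM normc_i mul1r.
have h4 : f (c - 'i * t%:C) <= f c by apply: near; rewrite normcN normcM normc_i mul1r.
have := hd _ t0 td; rewrite mulr1 => hl.
have := le_trans (abs_Re_le_normc _) hl; rewrite ler_norml => /andP[hl' _].
have e4 := normc_sqr_cross c t.
have t2 : 0 < ep * t ^+ 2 by rewrite mulr_gt0 ?exprn_gt0.
move: hl'; rewrite /cross_laplacian.
have Re4 (p q s k l : R[i]) : complex.Re (p + q + s + k - 4 * l) =
   complex.Re p + complex.Re q + complex.Re s + complex.Re k - 4 * complex.Re l.
  by case: p q s k l => [a1 b1] [a2 b2] [a3 b3] [a4 b4] [a5 b5] /=; ring.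
rewrite Re4 => hl'.
have {}e4 := congr1 ( *%R ep) e4.
rewrite /f in h1 h2 h3 h4; lra.
Qed.

End MaxPrinciple.

(** * Fourier modes by averaging over roots of unity *)

Section Modes.
Variable R : realType.
Implicit Types (g h chi : R[i] -> R[i]) (z w u v : R[i]).

(** The properties shared by [1], [z] and [z^*], the circular harmonics of
frequency [0], [1] and [-1], that the averaging argument uses. *)
Definition circle_mode chi :=
  [/\ weakly_harmonic chi,
      forall w z, normc w = 1 -> chi (w * z) = chi w * chi z,
      forall w, normc w = 1 -> normc (chi w) = 1,
      forall z, normc z <= 1 -> normc z <= normc (chi z) <= 1 &
      forall z w, normc (chi z - chi w) <= normc (z - w)].

Lemma circle_mode_cst : circle_mode (fun=> 1).
Proof.
split; [exact: weakly_harmonic_cst|by move=> *; rewrite mulr1|by move=> *;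
  exact: normc1| |].
  by move=> z z1; rewrite normc1 z1 lexx.
by move=> z w; rewrite subrr normc0 normc_ge0.
Qed.

Lemma circle_mode_id : circle_mode id.
Proof. by split => //; [exact: weakly_harmonic_id|move=> z ->; rewrite lexx]. Qed.

Lemma circle_mode_conj : circle_mode (fun z => z^*).
Proof.
split => //; first exact: (weakly_harmonic_conj (@weakly_harmonic_id R)).
- by move=> w z _; rewrite conjcM.
- by move=> w w1; rewrite normc_conj.
- by move=> z z1; rewrite normc_conj lexx.
- by move=> z w; rewrite -conjcB normc_conj.
Qed.

(** The discrete Fourier coefficient, at the frequency of [chi], of [g] on the
points [w ^+ k * z]. *)
Definition twisted_avg chi g N w z : R[i] :=
  N%:R^-1 * \sum_(k < N) (chi (w ^+ k))^* * g (w ^+ k * z).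

Lemma normc_nat n : normc (n%:R : R[i]) = n%:R.
Proof. by rewrite -(rmorph_nat (real_complex R)) normc_real ger0_norm ?ler0n. Qed.

Lemma twisted_avg_bound chi g N w z b : circle_mode chi -> (0 < N)%N -> normc w = 1 ->
  (forall k, normc (g (w ^+ k * z)) <= b) -> normc (twisted_avg chi g N w z) <= b.
Proof.
move=> [_ _ ch1 _ _] N0 w1 hb.
have N0' : 0 < N%:R :> R by rewrite ltr0n.
rewrite /twisted_avg normcM normcV normc_nat.
rewrite mulrC ler_pdivrMr //; apply: le_trans (normc_sum _ _ _) _.
have -> : b * N%:R = \sum_(k < N) b by rewrite sumr_const card_ord mulr_natr.
apply: ler_sum => k _; rewrite normcM normc_conj ch1 ?mul1r //.
by rewrite normcX w1 expr1n.
Qed.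

Lemma sum_shift (F : nat -> R[i]) N j : (forall k, F (k + N)%N = F k) ->
  \sum_(k < N) F (k + j)%N = \sum_(k < N) F k.
Proof.
move=> FN; elim: j => [|j IH]; first by apply: eq_bigr => k _; rewrite addn0.
rewrite -IH; case: N FN {IH} => [|N] FN; first by rewrite !big_ord0.
rewrite big_ord_recr [RHS]big_ord_recl /= addrC; congr (_ + _).
  by rewrite -[in RHS]FN; congr F; lia.
by apply: eq_bigr => k _; congr F; rewrite /= /bump /=; lia.
Qed.

(** Reindexing the cyclic group [<w>]: the average is an eigenfunction of the
rotation by [w ^+ j]. *)
Lemma twisted_avg_rot chi g N w z j : circle_mode chi -> w ^+ N = 1 -> normc w = 1 ->
  twisted_avg chi g N w (w ^+ j * z) = chi (w ^+ j) * twisted_avg chi g N w z.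
Proof.
move=> [_ chM ch1 _ _] wN w1.
have wk k : normc (w ^+ k) = 1 by rewrite normcX w1 expr1n.
rewrite /twisted_avg mulrCA; congr (_ * _); rewrite mulr_sumr.
rewrite -(@sum_shift (fun k => chi (w ^+ j) * ((chi (w ^+ k))^* * g (w ^+ k *
  z))) N j); last first.
  by move=> k; rewrite exprD wN mulr1.
apply: eq_bigr => k _; rewrite exprD chM // conjcM !mulrA; congr (_ * _).
by rewrite mulrAC mulc_conj ch1 // expr1n mul1r.
Qed.

Lemma weakly_harmonic_twisted_avg chi g N w : normc w = 1 -> weakly_harmonic g ->
  weakly_harmonic (twisted_avg chi g N w).
Proof.
move=> w1 hg; apply: weakly_harmonic_scale; apply: weakly_harmonic_sum => k.
by apply: weakly_harmonic_scale; apply: weakly_harmonic_rot => //;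
  rewrite normcX w1 expr1n.
Qed.

Definition dense_group (d : R) N w :=
  [/\ (0 < N)%N, w ^+ N = 1, normc w = 1 &
      forall z, normc z = 1 -> exists k, normc (z - w ^+ k) < d].

(** On the circle of radius [r] every point is close to some [w ^+ j * r], so the
average [M] of [g] differs little from [M r * chi (z / r)] there.  Both sides
are harmonic; multiplying by [chi r] avoids evaluating [chi] outside the disk,
and the maximum principle extends the comparison to a small point [s].  There
[|M s|] is at most [e / 2 * s] as [g] vanishes to first order, while
[|chi s| >= s]. *)
Lemma circle_mode_vanish chi g (r B : R) : circle_mode chi -> weakly_harmonic g ->
  0 < r -> r < 1 ->
  (forall z, normc z <= r -> normc (g z) <= B) ->
  (forall e : R, 0 < e -> exists2 d : R, 0 < d &
     forall z, normc z < d -> normc (g z) <= e * normc z) ->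
  forall e : R, 0 < e -> exists2 d : R, 0 < d &
    forall N w, dense_group d N w -> normc (twisted_avg chi g N w r%:C) <= e.
Proof.
move=> mchi hg r0 r1 hB ho e e0; have [hchi chM ch1 chb chl] := mchi.
have nr : normc (r%:C : R[i]) = r by rewrite normc_real gtr0_norm.
have B0 : 0 <= B by apply: le_trans (normc_ge0 (g r%:C)) (hB _ _); rewrite nr.
have e2 : 0 < e / 2 by lra.
have [r2 r20 hr2] := ho _ e2.
pose s := Num.min r2 r / 2.
have s0 : 0 < s by rewrite divr_gt0 // lt_min r20.
have sr2 : s < r2.
  have : Num.min r2 r <= r2 by rewrite ge_min lexx.
  by rewrite /s in s0 *; lra.
have sr : s < r.
  have : Num.min r2 r <= r by rewrite ge_min lexx orbT.
  by rewrite /s in s0 *; lra.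
have ns : normc (s%:C : R[i]) = s by rewrite normc_real gtr0_norm.
have es : 0 < e * s by rewrite mulr_gt0.
have es4 : 0 < e * s / 4 by lra.
have cg z : normc z <= r -> cts_at g z.
  by move=> zr; have [] := hg z (le_lt_trans zr r1).
have [d1 d10 hd1] := cts_at_uniform cg es4.
pose d2 := e * s / 4 / (B + 1).
have d20 : 0 < d2 by rewrite divr_gt0 //; lra.
have d2B : d2 * B <= e * s / 4.
  rewrite /d2 mulrAC ler_pdivrMr; last by lra.
  by rewrite ler_wpM2l; lra.
exists (Num.min d1 d2); first by rewrite lt_min d10.
move=> N w [N0 wN w1 dense].
have wk k : normc (w ^+ k) = 1 by rewrite normcX w1 expr1n.
set M := twisted_avg chi g N w.
have hM : weakly_harmonic M by exact: weakly_harmonic_twisted_avg.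
have Mr : normc (M r%:C) <= B.
  by apply: twisted_avg_bound => // k; apply: hB; rewrite normcM wk mul1r nr.
(* The error of the approximation [M z ~ M r * chi z / chi r], cleared of its
   denominator. *)
pose E z := chi r%:C * M z + (- M r%:C) * chi z.
have hE : weakly_harmonic E by apply: weakly_harmonic_add; apply: weakly_harmonic_scale.
have chr : normc (chi r%:C) <= 1.
  by have := chb r%:C; rewrite nr (ltW r1) => /(_ isT)/andP[].
have circle z : normc z = r -> normc (E z) <= e * s / 2.
  move=> zr; have rC : r%:C != 0 :> R[i] by rewrite -normc_gt0 nr.
  pose t := z / r%:C.
  have t1 : normc t = 1 by rewrite normcM normcV zr nr divff ?gt_eqF.
  have zE : z = t * r%:C by rewrite divfK.
  have [k] := dense t t1; rewrite lt_min => /andP[tk1 tk2].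
  pose t' := t / w ^+ k.
  have wk0 : w ^+ k != 0 by rewrite -normc_gt0 wk ltr01.
  have tE : t = w ^+ k * t' by rewrite mulrC divfK.
  have t'd : normc (t' - 1) < d1.
    have -> : t' - 1 = (t - w ^+ k) / w ^+ k by rewrite mulrBl divff.
    by rewrite normcM normcV wk invr1 mulr1.
  have hdiff : normc (M (t' * r%:C) - M r%:C) <= e * s / 4.
    have -> : M (t' * r%:C) - M r%:C = twisted_avg chi (fun z => g (t' * z) -
      g z) N w r%:C.
      rewrite /M /twisted_avg -mulrBr -sumrB; congr (_ * _); apply: eq_bigr => k' _.
      by rewrite mulrBr mulrCA.
    apply: twisted_avg_bound => // j; apply: ltW; apply: hd1;
      first by rewrite normcM wk mul1r nr.
    rewrite -{2}[w ^+ j * _]mul1r -mulrBl normcM normcM wk mul1r nr.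
    by apply: le_lt_trans t'd; rewrite ler_piMr ?normc_ge0 // ltW.
  have -> : E z = chi r%:C * (chi (w ^+ k) * (M (t' * r%:C) - M r%:C) +
      (chi (w ^+ k) - chi t) * M r%:C).
    rewrite /E zE chM // {1}tE -mulrA [M (_ * _)]twisted_avg_rot // -/M; ring.
  rewrite normcM; apply: le_trans (ler_wpM2r (normc_ge0 _) chr) _.
  rewrite mul1r; apply: le_trans (le_normcD _ _) _;
    rewrite [normc (chi (w ^+ k) * _)]normcM ch1 // mul1r.
  rewrite [normc (_ * M _)]normcM.
  have : normc (chi (w ^+ k) - chi t) * normc (M r%:C) <= d2 * B.
    apply: ler_pM; rewrite ?normc_ge0 //; apply: le_trans (chl _ _) _.
    by rewrite normc_distC ltW.
  lra.
have sles : normc (s%:C : R[i]) <= r by rewrite ns ltW.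
have hEs := max_principle hE r0 r1 circle sles.
have Ms : normc (M s%:C) <= e / 2 * s.
  apply: twisted_avg_bound => // k; have := hr2 (w ^+ k * s%:C).
  by rewrite normcM wk mul1r ns; apply.
have key : normc (M r%:C * chi s%:C) <= e * s.
  have -> : M r%:C * chi s%:C = chi r%:C * M s%:C - E s%:C by rewrite /E; ring.
  apply: le_trans (le_normcD _ _) _; rewrite normcN [normc (_ * M _)]normcM.
  have : normc (chi r%:C) * normc (M s%:C) <= 1 * (e / 2 * s).
    by apply: ler_pM; rewrite ?normc_ge0.
  lra.
rewrite -(ler_pM2r s0); apply: le_trans key; rewrite [normc (M _ * _)]normcM.
rewrite ler_wpM2l ?normc_ge0 //.
have s1 : s <= 1 by lra.
by have := chb s%:C; rewrite ns => /(_ s1)/andP[].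
Qed.

End Modes.

(** * A Schwarz-Pick inequality at a conformal point *)

Section SchwarzPick.
Variable R : realType.
Implicit Types (g h chi : R[i] -> R[i]) (z w u v a : R[i]).

Lemma sum_root w N : w ^+ N = 1 -> w != 1 -> \sum_(k < N) w ^+ k = 0.
Proof.
move=> wN w1; have := subrX1 w N; rewrite wN subrr => /esym/eqP.
by rewrite mulf_eq0 subr_eq0 (negbTE w1) => /eqP.
Qed.

Lemma conjc_sum (I : Type) (r : seq I) (F : I -> R[i]) :
  (\sum_(i <- r) F i)^* = \sum_(i <- r) (F i)^*.
Proof.
elim: r => [|i r IH]; last by rewrite !big_cons conjcD IH.
by rewrite !big_nil conjc_zero.
Qed.

Lemma unit_conj w : normc w = 1 -> w * w^* = 1.
Proof. by move=> w1; rewrite mulc_conj w1 expr1n. Qed.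

(** On the unit circle this is [w^* (1 + a^* w)^2]: the conjugate, multiplied by the
nonnegative weight [|1 + a^* w|^2], of [(a + w) / (1 + a^* w)], the boundary
values of the disk automorphism for which the inequality is an equality. *)
Definition extremal_poly a w := 2 * a^* + a^* ^+ 2 * w + w^*.

Lemma extremal_poly_norm a w : normc w = 1 ->
  (normc (extremal_poly a w))%:C = 1 + (normc a ^+ 2)%:C + a^* * w + a * w^*.
Proof.
move=> w1; have -> : extremal_poly a w = w^* * (1 + a^* * w) ^+ 2.
  rewrite /extremal_poly.
  have -> : w^* * (1 + a^* * w) ^+ 2 = w^* + 2 * a^* * (w * w^*) + a^* ^+ 2 * w *
    (w * w^*) by ring.
  by rewrite (unit_conj w1); ring.
rewrite normcM normc_conj w1 mul1r normcX -mulc_conj conjcD conjcM conjc_invol conjc_one.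
rewrite -[(normc a ^+ 2)%:C]mulc_conj.
have -> : (1 + a^* * w) * (1 + a * w^*) = 1 + (a * a^*) * (w * w^*) + a^* * w + a *
  w^* by ring.
by rewrite (unit_conj w1) mulr1.
Qed.

(** Test [h] on the circle of radius [r] against [extremal_poly a].  The linear part
[a + l z] of [h] contributes [2 |a|^2 + l r], the remainder at most [4 e], and
[|h| <= 1] bounds the total by the mean [1 + |a|^2] of the modulus of the
polynomial. *)
Lemma schwarz_pick_real h a (l : R) : weakly_harmonic h ->
  (forall z, normc z < 1 -> normc (h z) <= 1) ->
  normc a <= 1 -> 0 <= l ->
  (forall e : R, 0 < e -> exists2 d : R, 0 < d &
     forall z, normc z < d -> normc (h z - a - l%:C * z) <= e * normc z) ->
  l <= 1 - normc a ^+ 2.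
Proof.
move=> hh h1 a1 l0 hexp.
pose g z := h z - a - l%:C * z.
have hg : weakly_harmonic g.
  have -> : g = (fun z => (h z + (- a)) + (- l%:C) * z).
    by apply/funext => z; rewrite /g mulNr.
  apply: weakly_harmonic_add;
    last exact: (weakly_harmonic_scale (- l%:C) (@weakly_harmonic_id R)).
  by apply: weakly_harmonic_add => //; exact: weakly_harmonic_cst.
suff key (r e : R) : 0 < r -> r < 1 -> 0 < e -> l * r <= 1 - normc a ^+ 2 + 4 * e.
  apply/ler_addgt0Pr => e e0.
  (* A radius close enough to [1] for the defect [l * (1 - r)] to be at most [e / 2]. *)
  pose r := 1 - e / (2 * (l + 1 + e)).
  have le0 : 0 < 2 * (l + 1 + e) by lra.
  have f0 : 0 < e / (2 * (l + 1 + e)) by rewrite divr_gt0.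
  have f1 : e / (2 * (l + 1 + e)) < 1 by rewrite ltr_pdivrMr //; lra.
  have f2 : l * (e / (2 * (l + 1 + e))) <= e / 2.
    rewrite mulrA ler_pdivrMr // (_ : e / 2 * (2 * (l + 1 + e)) = l * e + (1 + e) *
      e); last by field.
    by rewrite lerDl mulr_ge0; lra.
  have := key r (e / 8); rewrite /r; lra.
move=> r0 r1 e0.
have gB z : normc z <= r -> normc (g z) <= 2 + l.
  move=> zr; apply: le_trans (le_normcD _ _) _;
    rewrite normcN normcM normc_real ger0_norm //.
  apply: lerD; last by rewrite ler_piMr //; lra.
  by apply: le_trans (le_normcD _ _) _; rewrite normcN; apply: lerD => //; apply: h1; lra.
have [d1 d10 hd1] := circle_mode_vanish (@circle_mode_cst R) hg r0 r1 gB hexp e0.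
have [d2 d20 hd2] := circle_mode_vanish (@circle_mode_id R) hg r0 r1 gB hexp e0.
have [d3 d30 hd3] := circle_mode_vanish (@circle_mode_conj R) hg r0 r1 gB hexp e0.
pose d := Num.min d1 (Num.min d2 d3).
have d0 : 0 < d by rewrite !lt_min d10 d20 d30.
have [N [w [N0 wN w1 w2 dense]]] := @dense_roots R d d0.
have dg d' : d <= d' -> dense_group d' N w.
  move=> dd'; split => // z /dense[k hk]; exists k; exact: lt_le_trans hk dd'.
have {hd1} M1 := hd1 N w (dg d1 _).
have {hd2} M2 := hd2 N w (dg d2 _).
have {hd3} M3 := hd3 N w (dg d3 _).
have {}M1 := M1 ltac:(by rewrite /d ge_min lexx).
have {}M2 := M2 ltac:(by rewrite /d !ge_min lexx orbT).
have {}M3 := M3 ltac:(by rewrite /d !ge_min lexx !orbT).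
have wk k : normc (w ^+ k) = 1 by rewrite normcX w1 expr1n.
have w1' : w != 1 by apply: contra w2 => /eqP ->; rewrite expr1n.
(* The vanishing power sums are the orthogonality relations between the
   frequencies [-1], [0] and [1] on the group generated by [w]. *)
have S1 : \sum_(k < N) w ^+ k = 0 by exact: sum_root.
have S2 : \sum_(k < N) (w ^+ k) ^+ 2 = 0.
  under eq_bigr do rewrite -exprM mulnC exprM.
  by apply: sum_root w2; rewrite -exprM mulnC exprM wN expr1n.
have S1' : \sum_(k < N) (w ^+ k)^* = 0 by rewrite -conjc_sum S1 conjc_zero.
have Nn : N%:R != 0 :> R[i] by rewrite pnatr_eq0 -lt0n.
pose A := \sum_(k < N) extremal_poly a (w ^+ k) * (h (w ^+ k * r%:C)).
have cstsum (c : R[i]) : \sum_(k < N) c = N%:R * c.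
  by rewrite sumr_const card_ord mulr_natl.
have upper : normc A <= N%:R * (1 + normc a ^+ 2).
  have : normc A <= \sum_(k < N) normc (extremal_poly a (w ^+ k)).
    apply: le_trans (normc_sum _ _ _) _; apply: ler_sum => k _.
    rewrite normcM ler_piMr ?normc_ge0 //; apply: h1.
    by rewrite normcM wk mul1r normc_real gtr0_norm.
  move=> h2; apply: le_trans h2 _.
  have /complexI -> : (\sum_(k < N) normc (extremal_poly a (w ^+ k)))%:C =
     (N%:R * (1 + normc a ^+ 2))%:C :> R[i].
    rewrite rmorph_sum /=; under eq_bigr do rewrite extremal_poly_norm //.
    rewrite !big_split /= -!mulr_sumr S1 S1' !mulr0 !addr0 !cstsum.
    by rewrite [RHS]ofrealM ofrealD ofreal_nat mulrDr.
  exact: lexx.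
have main : A = N%:R * (2 * (normc a ^+ 2)%:C + (l * r)%:C) +
  N%:R * (2 * a^* * twisted_avg (fun=> 1) g N w r%:C + twisted_avg id g N w r%:C +
          a^* ^+ 2 * twisted_avg (fun z => z^*) g N w r%:C).
  have -> : A = \sum_(k < N) extremal_poly a (w ^+ k) * (a + l%:C * (w ^+ k * r%:C)) +
                \sum_(k < N) extremal_poly a (w ^+ k) * g (w ^+ k * r%:C).
    rewrite -big_split /=; apply: eq_bigr => k _; rewrite -mulrDr /g; congr (_ * _); ring.
  congr (_ + _).
    transitivity (\sum_(k < N) ((2 * (a * a^*) + l%:C * r%:C) +
       (a^* ^+ 2 * a + 2 * a^* * l%:C * r%:C) * w ^+ k +
       a * (w ^+ k)^* + a^* ^+ 2 * l%:C * r%:C * (w ^+ k) ^+ 2)).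
      apply: eq_bigr => k _; have hk := unit_conj (wk k).
      transitivity (2 * (a * a^*) + l%:C * r%:C * (w ^+ k * (w ^+ k)^*) +
       (a^* ^+ 2 * a + 2 * a^* * l%:C * r%:C) * w ^+ k +
       a * (w ^+ k)^* + a^* ^+ 2 * l%:C * r%:C * (w ^+ k) ^+ 2).
        by rewrite /extremal_poly; ring.
      by rewrite hk mulr1.
    rewrite !big_split /= -!mulr_sumr S1 S1' S2 !mulr0 !addr0 !cstsum.
    by rewrite -[(normc a ^+ 2)%:C]mulc_conj [(l * r)%:C]ofrealM; ring.
  have pull (n x1 x2 x3 c d' : R[i]) : n != 0 ->
    n * (c * (n^-1 * x1) + n^-1 * x2 + d' * (n^-1 * x3)) = c * x1 + x2 + d' * x3.
    by move=> n0; field.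
  rewrite /twisted_avg pull // !mulr_sumr -!big_split /=; apply: eq_bigr => k _.
  by rewrite conjc_invol conjc_one /extremal_poly; ring.
have err : normc (2 * a^* * twisted_avg (fun=> 1) g N w r%:C + twisted_avg id g N w r%:C +
          a^* ^+ 2 * twisted_avg (fun z => z^*) g N w r%:C) <= 4 * e.
  apply: le_trans (le_normcD _ _) _.
  have -> : 4 * e = (2 * e + e) + e by ring.
  have na0 := normc_ge0 a.
  apply: lerD; last first.
    rewrite normcM normcX normc_conj -[leRHS]mul1r; apply: ler_pM;
      rewrite ?normc_ge0 ?exprn_ge0 //.
    by rewrite expr_le1.
  apply: le_trans (le_normcD _ _) _; apply: lerD => //.
  rewrite normcM; apply: ler_pM; rewrite ?normc_ge0 //.
  by rewrite normcM normc_nat normc_conj; lra.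
have N0' : 0 < N%:R :> R by rewrite ltr0n.
have : N%:R * (2 * normc a ^+ 2 + l * r) <= N%:R * (1 + normc a ^+ 2) + N%:R * (4 * e).
  have -> : N%:R * (2 * normc a ^+ 2 + l * r) = normc ((N%:R * (2 * normc a ^+ 2 +
    l * r))%:C : R[i]).
    by rewrite normc_real ger0_norm // mulr_ge0 // addr_ge0 ?mulr_ge0 ?exprn_ge0
      ?normc_ge0 // ltW.
  have -> : (N%:R * (2 * normc a ^+ 2 + l * r))%:C = A - N%:R * (2 * a^* *
    twisted_avg (fun=> 1) g N w r%:C + twisted_avg id g N w r%:C +
          a^* ^+ 2 * twisted_avg (fun z => z^*) g N w r%:C) :> R[i].
    by rewrite main addrK [LHS]ofrealM ofrealD [(2 * _)%:C]ofrealM !ofreal_nat.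
  apply: le_trans (le_normcD _ _) _; rewrite normcN; apply: lerD => //.
  by rewrite normcM normc_nat ler_wpM2l // ltW.
rewrite -mulrDr ler_pM2l //; lra.
Qed.

(** Reduction to a nonnegative coefficient by rotating the variable. *)
Lemma schwarz_pick h a al : weakly_harmonic h ->
  (forall z, normc z < 1 -> normc (h z) <= 1) -> normc a <= 1 ->
  (forall e : R, 0 < e -> exists2 d : R, 0 < d &
     forall z, normc z < d -> normc (h z - a - al * z) <= e * normc z) ->
  normc al <= 1 - normc a ^+ 2.
Proof.
move=> hh h1 a1 hexp; have [->|al0] := eqVneq al 0.
  by rewrite normc0 subr_ge0 expr_le1 ?normc_ge0.
have [u u1 ua] := eq_normc_unit al0.
have hr := weakly_harmonic_rot u1 hh.
apply: (schwarz_pick_real hr) => //; last 2 first.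
- exact: normc_ge0.
- move=> e e0; have [d d0 hd] := hexp e e0; exists d => // z zd.
  have := hd (u * z); rewrite normcM u1 mul1r => /(_ zd).
  by rewrite -ua; have -> : al * (u * z) = u * al * z by ring.
by move=> z z1; apply: h1; rewrite normcM u1 mul1r.
Qed.

Lemma schwarz_pick_conj h a al : weakly_harmonic h ->
  (forall z, normc z < 1 -> normc (h z) <= 1) -> normc a <= 1 ->
  (forall e : R, 0 < e -> exists2 d : R, 0 < d &
     forall z, normc z < d -> normc (h z - a - al * z^*) <= e * normc z) ->
  normc al <= 1 - normc a ^+ 2.
Proof.
move=> hh h1 a1 hexp; apply: (schwarz_pick (weakly_harmonic_conj hh)) => //.
  by move=> z z1; apply: h1; rewrite normc_conj.
move=> e e0; have [d d0 hd] := hexp e e0; exists d => // z zd.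
by have := hd z^*; rewrite normc_conj conjc_invol; apply.
Qed.

End SchwarzPick.

(** * Differentials and epsilons *)

Section EpsilonCalculus.
Variable R : realType.

Lemma differentiable_eps k m (f : 'rV[R]_k ->
  'rV[R]_m) (x : 'rV[R]_k) : differentiable f x ->
  forall e : R, 0 < e -> exists2 d : R, 0 < d &
    forall h : 'rV[R]_k, `|h| < d -> `|f (x + h) - f x - 'd f x h| <= e * `|h|.
Proof.
move=> df e e0.
have /eqaddoP /(_ e e0) := diff_locally df.
move=> /nbhs_rVP [d d0 hd]; exists d => // h hd'.
have := hd h; rewrite sub0r normrN => /(_ hd').
by rewrite [x + h]addrC opprD addrA.
Qed.

Lemma near_is_diff (V W : normedModType R) (f : V -> W) (x : V) (L : {linear V -> W}) :
  continuous L ->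
  (forall e : R, 0 < e -> \forall h \near (0 : V),
     `|f (h + x) - f x - L h| <= e * `|h|) ->
  differentiable f x /\ 'd f x = L :> (V -> W).
Proof.
move=> cL hL.
have fL : f \o shift x = cst (f x) + L +o_ 0 id.
  apply/eqaddoP => e e0; apply: filterS (hL e e0) => h.
  by rewrite -[(_ - _) h]/(f (h + x) - (f x + L h)) opprD addrA.
have dL := diff_unique cL fL.
by split => //; apply/diff_locallyP; rewrite dL.
Qed.

Lemma eps_is_diff k m (f : 'rV[R]_k -> 'rV[R]_m) (x : 'rV[R]_k)
    (L : {linear 'rV[R]_k -> 'rV[R]_m}) :
  continuous L ->
  (forall e : R, 0 < e -> exists2 d : R, 0 < d &
    forall h : 'rV[R]_k, `|h| < d -> `|f (x + h) - f x - L h| <= e * `|h|) ->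
  differentiable f x /\ 'd f x = L :> ('rV[R]_k -> 'rV[R]_m).
Proof.
move=> cL hL; apply: near_is_diff => // e e0.
have [d d0 hd] := hL e e0.
by apply/nbhs_rVP; exists d => // h; rewrite sub0r normrN [h + x]addrC => /hd.
Qed.

Lemma derive_partial m (f : 'rV[R]_2 -> 'rV[R]_m) (y e : 'rV[R]_2) : differentiable f y ->
  'D_e f y = e ord0 ord0 *: partial ord0 f y + e ord0 ord_max *: partial ord_max f y.
Proof.
move=> df; rewrite /partial !deriveE // -!linearZ -linearD; congr ('d f y _).
apply/rowP => j; rewrite !mxE eqxx /=.
case: j => [[|[|//]] hj] /=; rewrite ?mulr1 ?mulr0 ?addr0 ?add0r;
  by congr (e _ _); apply/val_inj.
Qed.

(** Differentiating along a line turns a statement about the plane into one about a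
real function, to which the mean value theorem applies. *)
Lemma is_derive_line m (f : 'rV[R]_2 -> 'rV[R]_m) (x e : 'rV[R]_2) (t : R) j :
  differentiable f (t *: e + x) ->
  is_derive t 1 (fun s : R => f (s *: e + x) ord0 j) ('D_e f (t *: e + x) ord0 j).
Proof.
move=> df; have dfe : derivable f (t *: e + x) e by exact: diff_derivable.
have E : (fun h : R => h^-1 *: (((fun s : R => f (s *: e + x) ord0 j) \o shift t) (h *: 1)
            - f (t *: e + x) ord0 j)) =
         (fun h : R => h^-1 *: (((fun y => f y ord0 j) \o shift (t *: e + x)) (h *: e)
            - f (t *: e + x) ord0 j)).
  apply/funext => h /=; congr (_ *: (f _ _ _ - _)).
  by rewrite scalerDl [h *: 1]mulr1 addrA.
have dj : derivable (fun y => f y ord0 j) (t *: e + x) e.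
  by have /derivable_mxP := dfe; apply.
apply: DeriveDef; first by rewrite /derivable E.
by rewrite derive_mx // mxE /derive E.
Qed.

(** The mean value theorem applied to the even function
[phi t + phi (- t) - L t^2], whose derivative is [o(t)] as [phi'] has the
derivative [L] at [0]. *)
Lemma symmetric_second (phi phi' : R -> R) (L b : R) : 0 < b ->
  (forall t : R, `|t| < b -> is_derive t (1 : R) phi (phi' t)) ->
  is_derive (0 : R) (1 : R) phi' L ->
  forall e : R, 0 < e -> exists2 d : R, 0 < d & forall t : R, 0 < t -> t < d ->
    `|phi t + phi (- t) - 2 * phi 0 - L * t ^+ 2| <= e * t ^+ 2.
Proof.
move=> b0 hphi hphi' e e0.
have e2 : 0 < e / 2 by lra.
have [d d0 hd] : exists2 d : R, 0 < d & forall t : R, `|t| < d ->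
    `|phi' t - phi' 0 - L * t| <= e / 2 * `|t|.
  have [dp dv] := hphi'.
  have /eqaddoP /(_ _ e2) /nbhs_ballP [d /= d0 hd] := derivable_nbhs dp.
  exists d => // t td; have := hd t; rewrite /ball /= sub0r normrN => /(_ td).
  rewrite -[(_ - _) t]/(phi' (t%:A + 0) - (phi' 0 + t * 'D_1 phi' 0)) dv.
  have -> : t%:A + 0 = t by rewrite addr0 [t%:A]mulr1.
  by rewrite [t * L]mulrC opprD addrA.
exists (Num.min b d); first by rewrite lt_min b0.
move=> t t0; rewrite lt_min => /andP[tb td].
pose g (s : R) := phi s + phi (- s) - L * s ^+ 2.
pose g' (s : R) := phi' s - phi' (- s) - 2 * L * s.
have hg (s : R) : `|s| < b -> is_derive s (1 : R) g (g' s).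
  move=> sb; have h1 := hphi s sb.
  have h2 : is_derive s (1 : R) (fun s => phi (- s)) (- phi' (- s)).
    have h3 : is_derive (- s) (1 : R) phi (phi' (- s)) by apply: hphi; rewrite normrN.
    have h4 : is_derive s (1 : R) (-%R : R -> R) (- 1) by exact: is_deriveNid.
    have := @is_derive1_comp R phi -%R s _ _ h3 h4.
    by rewrite mulrN1.
  have h5 : is_derive s (1 : R) (fun s : R => L * s ^+ 2) (2 * L * s).
    apply: is_derive_eq; rewrite /GRing.scale /=; ring.
  exact: (is_deriveB (is_deriveD h1 h2) h5).
have [c] : exists2 c, c \in `]0, t[ & g t - g 0 = g' c * (t - 0).
  apply: MVT => //.
    move=> s; rewrite in_itv /= => /andP[s0 st]; apply: hg; rewrite gtr0_norm //.
    exact: lt_trans tb.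
  apply: continuous_in_subspaceT => s; rewrite inE /= in_itv /= => /andP[s0 st].
  have sb : `|s| < b by rewrite ger0_norm //; exact: le_lt_trans tb.
  have [dg _] := hg s sb.
  by apply: differentiable_continuous; apply/derivable1_diffP.
rewrite in_itv /= => /andP[c0 ct].
rewrite subr0 /g /= oppr0 expr0n /= mulr0 subr0 => ge.
have -> : phi t + phi (- t) - 2 * phi 0 - L * t ^+ 2 = g' c * t by rewrite -ge; ring.
rewrite normrM (gtr0_norm t0) expr2 mulrA ler_wpM2r ?(ltW t0) //.
have cd : `|c| < d by rewrite gtr0_norm //; lra.
have h1 := hd c cd.
have h2 := hd (- c); rewrite normrN in h2; have {}h2 := h2 cd.
have -> : g' c = (phi' c - phi' 0 - L * c) - (phi' (- c) - phi' 0 - L * - c).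
  by rewrite /g'; ring.
apply: le_trans (ler_normB _ _) _.
rewrite (gtr0_norm c0) in h1 h2.
have : e * c <= e * t by rewrite ler_wpM2l ?ltW.
move: h1 h2; set p1 := `|_|; set p2 := `|_|; lra.
Qed.

End EpsilonCalculus.

(** * From the Laplacian to second differences *)

Section HarmonicCoordinates.
Variable R : realType.

Lemma sum_ord2 (V : zmodType) (F : 'I_2 -> V) : \sum_(i < 2) F i = F ord0 + F ord_max.
Proof.
rewrite !big_ord_recl big_ord0 addr0; congr (_ + F _); exact/val_inj.
Qed.

Lemma unit_diskE (z : R[i]) : unit_disk z <-> normc z < 1.
Proof. by rewrite /unit_disk /= norm_normc ltcR. Qed.

Lemma plane_line (z u : R[i]) (t : R) : plane (z + t%:C * u) = t *: plane u + plane z.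
Proof.
apply/rowP => j; rewrite !mxE; case: z u => a b [c d] /=.
by case: ifP => _; ring.
Qed.

Definition second_form (a b c d : R) (u : R[i]) : R :=
  complex.Re u * (complex.Re u * a + complex.Im u * b) +
  complex.Im u * (complex.Re u * c + complex.Im u * d).

(** The mixed terms [b] and [c] cancel between the two orthogonal directions. *)
Lemma second_form_i a b c d u : a + d = 0 ->
  second_form a b c d ('i * u) = - second_form a b c d u.
Proof.
move=> /eqP; rewrite addr_eq0 => /eqP ->; rewrite /second_form.
by case: u => p q /=; ring.
Qed.

Section C2Coordinates.
Variables (m : nat) (f : 'rV[R]_2 -> 'rV[R]_m).
Hypothesis C2 : C2_on (@of_plane R @^-1` @unit_disk R) f.

Definition second_derivative_along (u : R[i]) (x : 'rV[R]_2) j : R :=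
  second_form (partial ord0 (partial ord0 f) x ord0 j)
    (partial ord_max (partial ord0 f) x ord0 j)
    (partial ord0 (partial ord_max f) x ord0 j)
    (partial ord_max (partial ord_max f) x ord0 j) u.

(** Along the line through [z] in the direction [u] the first derivative is a
combination of the two partial derivatives, which are differentiable again. *)
Lemma second_difference (z u : R[i]) j (e : R) : normc z < 1 -> 0 < e ->
  exists2 d : R, 0 < d & forall t : R, 0 < t -> t < d ->
    `|f (plane (z + t%:C * u)) ord0 j + f (plane (z - t%:C * u)) ord0 j
       - 2 * f (plane z) ord0 j - second_derivative_along u (plane z) j * t ^+ 2|
    <= e * t ^+ 2.
Proof.
move=> z1 e0; have [C1f C1p] := C2.
pose b := (1 - normc z) / (normc u + 1).
have u0 := normc_ge0 u.
have b0 : 0 < b by rewrite divr_gt0; lra.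
pose x := plane z; pose v := plane u.
have v0 : v ord0 ord0 = complex.Re u by rewrite mxE.
have v1 : v ord0 ord_max = complex.Im u by rewrite mxE.
have inD (t : R) : `|t| < b -> (@of_plane R @^-1` @unit_disk R) (t *: v + x).
  move=> tb; apply/unit_diskE; rewrite -plane_line planeK.
  apply: le_lt_trans (le_normcD _ _) _; rewrite normcM normc_real.
  have : `|t| * (normc u + 1) < 1 - normc z by rewrite -ltr_pdivlMr //; lra.
  have := normr_ge0 t; lra.
have line (g : 'rV[R]_2 -> 'rV[R]_m) (t : R) : differentiable g (t *: v + x) ->
  is_derive t (1 : R) (fun s : R => g (s *: v + x) ord0 j)
    (complex.Re u * partial ord0 g (t *: v + x) ord0 j +
     complex.Im u * partial ord_max g (t *: v + x) ord0 j).
  move=> dg; have := is_derive_line j dg; rewrite derive_partial // v0 v1.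
  suff -> : (complex.Re u *: partial ord0 g (t *: v + x) +
    complex.Im u *: partial ord_max g (t *: v + x)) ord0 j =
    complex.Re u * partial ord0 g (t *: v + x) ord0 j +
     complex.Im u * partial ord_max g (t *: v + x) ord0 j by [].
  by rewrite mxE; congr (_ + _); rewrite mxE.
have b00 : `|0 : R| < b by rewrite normr0.
pose phi' (t : R) := complex.Re u * partial ord0 f (t *: v + x) ord0 j +
     complex.Im u * partial ord_max f (t *: v + x) ord0 j.
have h1 (t : R) : `|t| < b -> is_derive t (1 : R) (fun s : R => f (s *: v +
  x) ord0 j) (phi' t).
  by move=> tb; apply: line; have [] := C1f _ (inD t tb).
have h2 : is_derive (0 : R) (1 : R) phi' (second_derivative_along u x j).
  have p0 := line _ _ (C1p ord0 _ (inD 0 b00)).1.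
  have p1 := line _ _ (C1p ord_max _ (inD 0 b00)).1.
  rewrite scale0r add0r in p0 p1.
  exact: (is_deriveD (is_deriveZ (complex.Re u) p0) (is_deriveZ (complex.Im u) p1)).
have [d d0 hd] := symmetric_second b0 h1 h2 e0.
exists d => // t t0 td; have := hd t t0 td.
rewrite scale0r add0r plane_line.
have -> : z - t%:C * u = z + (- t)%:C * u by rewrite rmorphN mulNr.
by rewrite plane_line.
Qed.

Lemma harmonic_coord_weakly_harmonic j :
  (forall u, unit_disk (of_plane u) -> laplacian f u = 0) ->
  weakly_harmonic (fun z => (f (plane z) ord0 j)%:C).
Proof.
move=> lap0 z z1; have zD : (@of_plane R @^-1` @unit_disk R) (plane z).
  by apply/unit_diskE; rewrite planeK.
split.
  move=> e e0; have [C1f _] := C2; have [df _] := C1f _ zD.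
  have cf : {for plane z, continuous f} by exact: differentiable_continuous.
  have [d d0 hd] : exists2 d : R, 0 < d & forall y, `|plane z - y| < d ->
    `|f (plane z) - f y| < e.
    have := cf _ (nbhsx_ballx (f (plane z)) e e0) => /nbhs_rVP [d d0 hd];
      exists d => // y yd.
    by have := hd y yd; rewrite /= -ball_normE.
  exists d => // w wz; rewrite -rmorphB normc_real.
  have -> : f (plane w) ord0 j - f (plane z) ord0 j = (f (plane w) -
    f (plane z)) ord0 j by rewrite !mxE.
  apply: le_lt_trans (normr_coord _ _) _; rewrite distrC; apply: hd.
  have -> : plane z - plane w = plane (z - w).
    by apply/rowP => k; rewrite !mxE; case: (z) (w) => [a b] [a' b'] /=; case: ifP.
  by apply: le_lt_trans (norm_plane _) _; rewrite normc_distC.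
move=> u e e0; have e2 : 0 < e / 2 by lra.
have [d1 d10 hd1] := second_difference u j z1 e2.
have [d2 d20 hd2] := second_difference ('i * u) j z1 e2.
exists (Num.min d1 d2); first by rewrite lt_min d10.
move=> t t0; rewrite lt_min => /andP[td1 td2].
have {hd1} := hd1 t t0 td1; have {hd2} := hd2 t t0 td2.
have L0 : second_derivative_along ('i * u) (plane z) j = -
  second_derivative_along u (plane z) j.
  have lz : laplacian f (plane z) = 0 by apply: lap0; exact: zD.
  apply: second_form_i; rewrite /laplacian sum_ord2 in lz.
  by move/rowP: lz => /(_ j); rewrite [X in X = _]mxE [X in _ = X]mxE.
rewrite L0 /cross_laplacian.
have -> : t%:C * ('i * u) = 'i * (t%:C * u) by ring.
set p1 := f (plane (z + t%:C * u)) ord0 j; set p2 := f (plane (z - t%:C * u)) ord0 j.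
set p3 := f (plane (z + 'i * (t%:C * u))) ord0 j;
  set p4 := f (plane (z - 'i * (t%:C * u))) ord0 j.
set p0 := f (plane z) ord0 j; set L := second_derivative_along _ _ _.
move=> h2 h1.
have -> : p1%:C + p2%:C + p3%:C + p4%:C - 4 * p0%:C =
  ((p1 + p2 - 2 * p0 - L * t ^+ 2) + (p3 + p4 - 2 * p0 - - L * t ^+ 2))%:C.
  rewrite [RHS](_ : _ = (p1 + p2 + p3 + p4 - 4 * p0)%:C); last by congr (_%:C); ring.
  by apply/eqP; rewrite eq_complex /=; apply/andP; split; apply/eqP; ring.
rewrite normc_real; apply: le_trans (ler_normD _ _) _; lra.
Qed.
End C2Coordinates.
End HarmonicCoordinates.

(** * The stretch seen through a complex functional *)

Section FunctionalBound.
Variables (R : realType) (n : nat).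
Implicit Types (z w v : Cvec R n) (F : Cplx R -> Cvec R n).

Definition pairing (b : 'I_n -> R[i]) z : R[i] := \sum_(j < n) b j * z ord0 j.

Lemma pairingZ b (c : R[i]) z : pairing b (c *: z : Cvec R n) = c * pairing b z.
Proof. by rewrite /pairing mulr_sumr; apply: eq_bigr => j _; rewrite mxE mulrCA. Qed.

Lemma cnorm_sqr z : cnorm z ^+ 2 = \sum_(j < n) normc (z ord0 j) ^+ 2.
Proof.
have E : cdot z z = \sum_(j < n) normc (z ord0 j) ^+ 2.
  rewrite /cdot raddf_sum; apply: eq_bigr => j _ /=.
  by rewrite normc_sqr; case: (z ord0 j) => a b /=; ring.
rewrite /cnorm E sqr_sqrtr // sumr_ge0 // => j _; exact: sqr_ge0.
Qed.

Lemma cnorm_ge0 z : 0 <= cnorm z.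
Proof. exact: sqrtr_ge0. Qed.

Lemma cnormZ (c : R[i]) z : cnorm (c *: z : Cvec R n) = normc c * cnorm z.
Proof.
apply/eqP; rewrite -(@eqrXn2 _ 2) ?cnorm_ge0 ?mulr_ge0 ?normc_ge0 ?cnorm_ge0 //.
rewrite exprMn !cnorm_sqr mulr_sumr; apply/eqP; apply: eq_bigr => j _.
by rewrite mxE normcM exprMn.
Qed.

Lemma of_plane0 : @of_plane R 0 = 0.
Proof. by apply/eqP; rewrite eq_complex /= !mxE !eqxx. Qed.

Lemma coord_realify F (x : R[i]) j :
  F x ord0 j = (real_form F (plane x) ord0 (lshift n j))%:C +
    'i * (real_form F (plane x) ord0 (rshift n j))%:C.
Proof.
rewrite /real_form planeK /realify row_mxEl row_mxEr !mxE.
by case: (F x ord0 j) => a b; apply/eqP; rewrite eq_complex /=; apply/andP; split;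
  apply/eqP; ring.
Qed.

Lemma pairing_weakly_harmonic b F : harmonic_map F ->
  weakly_harmonic (fun x => pairing b (F x)).
Proof.
move=> [C2F lap0]; apply: (@weakly_harmonic_sum _ _ _ (fun j x => b j * F x ord0 j)) => j.
apply: weakly_harmonic_scale.
have -> : (fun x => F x ord0 j) =
  (fun x => (real_form F (plane x) ord0 (lshift n j))%:C +
    'i * (real_form F (plane x) ord0 (rshift n j))%:C).
  by apply/funext => x; exact: coord_realify.
apply: weakly_harmonic_add; last apply: weakly_harmonic_scale;
  exact: harmonic_coord_weakly_harmonic.
Qed.

Lemma pairing_expansion b F : harmonic_map F ->
  forall e : R, 0 < e -> exists2 d : R, 0 < d & forall x : R[i], normc x < d ->
    normc (pairing b (F x) - pairing b (F 0) - pairing b (dF0 F (plane x))) <= e *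
      normc x.
Proof.
move=> [[C1F _] _] e e0.
have D0 : (@of_plane R @^-1` @unit_disk R) 0.
  by apply/unit_diskE; rewrite of_plane0 normc0.
have [df _] := C1F _ D0.
pose B := \sum_(j < n) normc (b j) + 1.
have B0 : 0 < B.
  have : 0 <= \sum_(j < n) normc (b j) by apply: sumr_ge0 => j _; exact: normc_ge0.
  by rewrite /B; lra.
have e' : 0 < e / (2 * B) by rewrite divr_gt0 //; lra.
have [d d0 hd] := differentiable_eps df e'.
exists d => // x xd.
have hx : `|real_form F (0 + plane x) - real_form F 0 -
  'd (real_form F) 0 (plane x)| <= e / (2 * B) * normc x.
  apply: le_trans (hd _ _) _; first exact: le_lt_trans (norm_plane _) xd.
  by rewrite ler_wpM2l ?(ltW e') // norm_plane.
rewrite add0r in hx.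
have p0 : plane (0 : R[i]) = 0 by rewrite -of_plane0 of_planeK.
have hj j : normc (F x ord0 j - F 0 ord0 j - dF0 F (plane x) ord0 j) <= 2 * (e / (2 *
  B) * normc x).
  apply: le_trans (normc_le_ReIm _) _; rewrite mulr_natl mulr2n; apply: lerD.
    apply: le_trans hx; apply: le_trans (normr_coord _ (lshift n j)).
    rewrite /dF0 /unrealify !coord_realify p0 /= !mxE /=.
    by rewrite le_eqVlt; apply/orP; left; apply/eqP; congr (`|_|); ring.
  apply: le_trans hx; apply: le_trans (normr_coord _ (rshift n j)).
  rewrite /dF0 /unrealify !coord_realify p0 /= !mxE /=.
  by rewrite le_eqVlt; apply/orP; left; apply/eqP; congr (`|_|); ring.
rewrite /pairing -!sumrB; apply: le_trans (normc_sum _ _ _) _.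
have nx0 := normc_ge0 x.
apply: le_trans (_ : \sum_(j < n) normc (b j) * (e / B * normc x) <= _).
  apply: ler_sum => j _; rewrite -!mulrBr normcM ler_wpM2l ?normc_ge0 //.
  apply: le_trans (hj j) _; rewrite le_eqVlt; apply/orP; left; apply/eqP.
  by field; rewrite gt_eqF.
rewrite -mulr_suml (_ : e * normc x = B * (e / B * normc x)); last by field;
  rewrite gt_eqF.
rewrite ler_wpM2r //; last by rewrite /B; lra.
by rewrite mulr_ge0 // divr_ge0 // ltW.
Qed.

Lemma dF0_plane F (x : R[i]) :
  dF0 F (plane x) = (complex.Re x)%:C *: dF0 F (plane 1) +
    (complex.Im x)%:C *: dF0 F (plane 'i) :> Cvec R n.
Proof.
rewrite /dF0.
have -> : plane x = complex.Re x *: plane 1 + complex.Im x *: plane 'i.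
  by apply/rowP => j; rewrite !mxE; case: x => a b /=; case: ifP => _; ring.
rewrite linearD !linearZ /=; move: ('d _ _ _) ('d _ _ _) => A B.
apply/rowP => j; rewrite !mxE; apply/eqP; rewrite eq_complex /=.
by apply/andP; split; apply/eqP; ring.
Qed.

Lemma enorm_plane (x : R[i]) : enorm (plane x) = normc x.
Proof. by rewrite /enorm sum_ord2 !mxE; case: x. Qed.

(** A real linear conformal map of the plane is complex linear or antilinear.  With
[al = a + b i] and [be = c + d i] the values at [1] and [i], conformality gives
[a^2 + b^2 = c^2 + d^2] and [a c + b d = 0]; then the product of
[|be + i al|^2] and [|be - i al|^2] vanishes. *)
Lemma conformal_dichotomy (al be : R[i]) (l : R) : 0 < l ->
  (forall x : R[i], normc ((complex.Re x)%:C * al + (complex.Im x)%:C * be) = l *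
    normc x) ->
  normc al = l /\
  ((forall x : R[i], (complex.Re x)%:C * al + (complex.Im x)%:C * be = al * x) \/
   (forall x : R[i], (complex.Re x)%:C * al + (complex.Im x)%:C * be = al * x^*)).
Proof.
move=> l0 h; have h1 := h 1; have h2 := h 'i; have h3 := h (1 + 'i).
have sq (x : R[i]) := congr1 (fun y => y ^+ 2) (h x).
have {h1} h1 : normc al = l.
  by move: h1; rewrite [X in normc (X + _)]mul1r [X in normc (_ +
    X)]mul0r addr0 normc1 mulr1.
split => //.
have s2 := sq 'i; have s3 := sq (1 + 'i); have s1 := sq 1.
clear sq h h1 h2 h3.
rewrite !exprMn !normc_sqr in s1 s2 s3.
case: al be s1 s2 s3 => a b [c d] /= s1 s2 s3.
rewrite ?(mul1r, mul0r, addr0, add0r, subr0, expr1n, mulr1, expr0n) /= in s1 s2 s3.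
have orth : a * c + b * d = 0 by lra.
have : ((c + b) ^+ 2 + (d - a) ^+ 2) * ((c - b) ^+ 2 + (d + a) ^+ 2) = 0.
  transitivity ((a ^+ 2 + b ^+ 2 + (c ^+ 2 + d ^+ 2)) ^+ 2 - 4 * (a ^+ 2 + b ^+ 2) *
    (c ^+ 2 + d ^+ 2) + 4 * (a * c + b * d) ^+ 2).
    by ring.
  by rewrite orth (_ : c ^+ 2 + d ^+ 2 = a ^+ 2 + b ^+ 2); [ring|lra].
move/eqP; rewrite mulf_eq0 !paddr_eq0 ?sqr_ge0 // !sqrf_eq0.
case/orP => /andP[/eqP k1 /eqP k2]; [left|right] => -[x y]; apply/eqP;
  rewrite eq_complex /=; apply/andP; split; apply/eqP.
- have -> : c = - b by lra. ring.
- have -> : d = a by lra. ring.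
- have -> : c = b by lra. ring.
- have -> : d = - a by lra. ring.
Qed.

(** The functional turns the disk into a bounded harmonic function whose
differential at [0] is that of the disk divided by [q], since the functional
takes the value [1 / q] at [v]. *)
Lemma stretch_bound F (G : set (Cvec R n)) v (c0 : R[i]) b (l q : R) :
  harmonic_map F -> (forall x : R[i], unit_disk x -> G (F x)) -> F 0 = c0 *: v ->
  0 < l -> (forall u, cnorm (dF0 F u) = l * enorm u) ->
  range (dF0 F) = complex_line v -> cnorm v = 1 ->
  0 < q -> (forall z, G z -> normc (pairing b z) <= 1) -> q%:C * pairing b v = 1 ->
  l <= (q ^+ 2 - normc c0 ^+ 2) / q.
Proof.
move=> hF FG F0 l0 hl hr v1 q0 bG bv.
have inL u : exists c : R[i], dF0 F u = c *: v.
  have : complex_line v (dF0 F u) by rewrite -hr; exists u.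
  by case=> c _ <-; exists c.
have [al hal] := inL (plane 1); have [be hbe] := inL (plane 'i).
have dF x : dF0 F (plane x) = ((complex.Re x)%:C * al + (complex.Im x)%:C * be) *: v.
  by rewrite dF0_plane hal hbe !scalerA scalerDl.
have nc x : normc ((complex.Re x)%:C * al + (complex.Im x)%:C * be) = l * normc x.
  by have := hl (plane x); rewrite dF cnormZ v1 mulr1 enorm_plane.
have [nal dich] := conformal_dichotomy l0 nc.
have qC : q%:C != 0 :> R[i] by rewrite -normc_gt0 normc_real gtr0_norm.
have bvE : pairing b v = q%:C^-1 by apply: (mulfI qC); rewrite bv divff.
have hw := pairing_weakly_harmonic b hF.
have hb x : normc x < 1 -> normc (pairing b (F x)) <= 1.
  by move=> x1; apply: bG; apply: FG; apply/unit_diskE.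
have F0E : pairing b (F 0) = c0 / q%:C by rewrite F0 pairingZ bvE.
have n0 : normc (c0 / q%:C) = normc c0 / q.
  by rewrite normcM normcV normc_real gtr0_norm.
have a1 : normc (c0 / q%:C) <= 1.
  by rewrite -F0E; apply: hb; rewrite normc0.
have hexp := pairing_expansion b hF.
have nal' : normc (al / q%:C) = l / q.
  by rewrite normcM normcV normc_real gtr0_norm // nal.
have : l / q <= 1 - (normc c0 / q) ^+ 2.
  rewrite -n0 -nal'; case: dich => hd.
    apply: (schwarz_pick hw hb a1) => e e0; have [d d0 hdd] := hexp e e0.
    exists d => // x /hdd; rewrite F0E dF pairingZ bvE hd.
    by rewrite [al * x / _]mulrAC.
  apply: (schwarz_pick_conj hw hb a1) => e e0; have [d d0 hdd] := hexp e e0.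
  exists d => // x /hdd; rewrite F0E dF pairingZ bvE hd.
  by rewrite [al * _ / _]mulrAC.
rewrite ler_pdivrMr // => h; apply: le_trans h _.
rewrite le_eqVlt; apply/orP; left; apply/eqP; field; exact: lt0r_neq0.
Qed.

End FunctionalBound.

(** * Separation from a balanced convex set *)

Section Separation.
Variables (R : realType) (n : nat).
Implicit Types (z w v : Cvec R n) (G : set (Cvec R n)).

Lemma normc_coord_le z j : normc (z ord0 j) <= cnorm z.
Proof.
rewrite -(@ler_pXn2r _ 2) ?nnegrE ?normc_ge0 ?cnorm_ge0 // cnorm_sqr.
by rewrite (bigD1 j) //= lerDl; apply: sumr_ge0 => k _; exact: sqr_ge0.
Qed.

Lemma open_cnorm_ball G : open G -> G 0 ->
  exists2 d : R, 0 < d & forall z, cnorm z < d -> G z.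
Proof.
move=> oG G0; have /nbhs_ballP [e /= e0 he] : nbhs (0 : Cvec R n) G.
  exact: open_nbhs_nbhs.
have eR : (complex.Re e)%:C = e by apply: RRe_real; exact: gtr0_real.
exists (complex.Re e); first by rewrite -ltcR eR.
move=> z ze; apply: he; split => // i j.
rewrite (ord1 i) -ball_normE /= mxE sub0r normrN norm_normc -eR ltcR.
exact: le_lt_trans (normc_coord_le z j) ze.
Qed.

Lemma bounded_cnorm_sqr G : bounded_set G ->
  exists K : R, forall z, G z -> cnorm z ^+ 2 <= K.
Proof.
move=> [M [Mreal hM]].
have M1 : M < M + 1 by rewrite ltrDl.
have MR : (complex.Re (M + 1))%:C = M + 1 by apply: RRe_real; rewrite realD.
exists (\sum_(j < n) complex.Re (M + 1) ^+ 2) => z Gz.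
rewrite cnorm_sqr; apply: ler_sum => j _.
have h : normc (z ord0 j) <= complex.Re (M + 1).
  rewrite -lecR -norm_normc MR; apply: le_trans (hM _ M1 z Gz).
  have -> : `|z| = mx_norm z by [].
  rewrite mx_normE -[leLHS]nngE num_le.
  exact: (le_bigmax _ (fun i => `|z i.1 i.2|%:nng) (ord0, j)).
by rewrite ler_pXn2r ?nnegrE ?normc_ge0 // (le_trans (normc_ge0 _) h).
Qed.

Lemma convex_comb G z w (t : R) : convex_set G -> G z -> G w -> 0 <= t -> t <= 1 ->
  G (t%:C *: z + (1 - t)%:C *: w).
Proof.
move=> cG Gz Gw t0 t1.
have t0' : 0 <= t%:C :> Cplx R by rewrite ler0c.
have t1' : t%:C <= 1 :> Cplx R by rewrite -(rmorph1 (real_complex R)) lecR.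
have := cG z w (Itv01 t0' t1'); rewrite !inE => /(_ Gz Gw).
rewrite /conv /= /unstable.onem.
by have -> : (1 - t)%:C = 1 - t%:C :> Cplx R by rewrite rmorphB rmorph1.
Qed.

Definition conj_coords z : 'I_n -> R[i] := fun j => (z ord0 j)^*.

Lemma pairingB b z w : pairing b (z - w : Cvec R n) = pairing b z - pairing b w :> R[i].
Proof. by rewrite /pairing -sumrB; apply: eq_bigr => j _; rewrite !mxE mulrBr. Qed.

Lemma pairing_conj_coords z : complex.Re (pairing (conj_coords z) z) = cnorm z ^+ 2.
Proof.
rewrite cnorm_sqr /pairing raddf_sum; apply: eq_bigr => j _.
by rewrite /conj_coords mulrC mulc_conj.
Qed.

(** The polarised form of the Hermitian norm: the pairing with the conjugate
coordinates of [z] has the inner product with [z] as its real part. *)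
Lemma cnorm_sqrB z w (t : R) :
  cnorm (z - t%:C *: w : Cvec R n) ^+ 2 =
  cnorm z ^+ 2 - 2 * t * complex.Re (pairing (conj_coords z) w) + t ^+ 2 * cnorm w ^+ 2.
Proof.
rewrite !cnorm_sqr /pairing raddf_sum !mulr_sumr -sumrB -big_split /=.
apply: eq_bigr => j _; rewrite /conj_coords !mxE !normc_sqr.
by case: (z ord0 j) (w ord0 j) => a b [c d] /=; ring.
Qed.

Lemma cnorm_sqr_dist z w (K : R) : cnorm z ^+ 2 <= K -> cnorm w ^+ 2 <= K ->
  cnorm (z - w : Cvec R n) ^+ 2 <= 4 * K.
Proof.
move=> zK wK.
have h1 := cnorm_sqrB z w 1; have h2 := cnorm_sqrB z w (-1).
rewrite (_ : (1 : R)%:C = 1) // scale1r in h1.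
have := sqr_ge0 (cnorm (z - (-1)%:C *: w)); lra.
Qed.

(** The point [x = q y] is at positive distance from [G], for otherwise [y] would be
a convex combination of a point of [G] and of a point of a small ball in [G].
Let [D] be the infimum of the squared distances and [g0] an almost nearest
point, with a defect that is small against the step [t].  Comparing with
[g0 + t (g - g0)] shows that the inner product with [x - g0] grows by at
most [D / 2] from [g0] to any [g] in [G], while it grows by at least [D] from
[g0] to [x].  As [G] is balanced, the real part may then be replaced by the
modulus. *)
Lemma separation G (y : Cvec R n) (q : R) : open G -> bounded_set G -> balanced G ->
  convex_set G -> G 0 -> ~ G y -> 1 < q ->
  exists2 b, (forall z, G z -> normc (pairing b z) <= 1) & pairing b (q%:C *: y) = 1.
Proof.
move=> oG bdG bal cG G0 Gy q1.
have [dl dl0 hball] := open_cnorm_ball oG G0.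
have [K hK] := bounded_cnorm_sqr bdG.
set x : Cvec R n := q%:C *: y.
pose eta := dl * (q - 1).
have eta0 : 0 < eta by rewrite mulr_gt0 // subr_gt0.
have dist g : G g -> eta <= cnorm (x - g).
  move=> Gg; rewrite leNgt; apply/negP => lt; apply: Gy.
  have qC : q%:C != 0 :> R[i] by rewrite -normc_gt0 normc_real gtr0_norm; lra.
  have qC1 : (q - 1)%:C != 0 :> R[i] by rewrite -normc_gt0 normc_real gtr0_norm; lra.
  pose w : Cvec R n := (q - 1)%:C^-1 *: (x - g).
  have Gw : G w.
    apply: hball; rewrite cnormZ normcV normc_real gtr0_norm ?subr_gt0 //.
    by rewrite mulrC ltr_pdivrMr // subr_gt0.
  have -> : y = q^-1%:C *: g + (1 - q^-1)%:C *: w.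
    rewrite /w scalerA.
    have -> : (1 - q^-1)%:C * (q - 1)%:C^-1 = q%:C^-1 :> R[i].
      apply: (mulfI qC); rewrite mulfV // mulrA -rmorphM mulrBr mulr1 mulfV; last by lra.
      by rewrite mulfV.
    have -> : q^-1%:C = q%:C^-1 :> R[i] by rewrite fmorphV.
    by rewrite scalerBr addrC subrK /x scalerA mulVf // scale1r.
  apply: convex_comb => //; first by rewrite invr_ge0; lra.
  by rewrite invf_le1; lra.
pose S := [set cnorm (x - g) ^+ 2 | g in G].
have S0 : S !=set0 by exists (cnorm (x - 0) ^+ 2), 0.
have lbS : lbound S (eta ^+ 2).
  move=> _ [g Gg <-]; rewrite ler_pXn2r ?nnegrE ?cnorm_ge0 ?(ltW eta0) //; exact: dist.
have hinf : has_inf S by split => //; exists (eta ^+ 2).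
pose D := inf S.
have D0 : 0 < D by apply: lt_le_trans (lb_le_inf S0 lbS); rewrite exprn_gt0.
have DS g : G g -> D <= cnorm (x - g) ^+ 2.
  by move=> Gg; apply: ge_inf; [exact: hinf.2|exists g].
have K0 : 0 <= K by apply: le_trans (hK _ G0); exact: sqr_ge0.
(* [4 * K] bounds the squared diameter of [G], so that the quadratic term
   [t^2 |g - g0|^2] is at most [t * D / 2]. *)
pose t := Num.min 1 (D / (8 * K + 1)).
have k8 : 0 < 8 * K + 1 by lra.
have t0 : 0 < t by rewrite lt_min ltr01 divr_gt0.
have t1 : t <= 1 by rewrite ge_min lexx.
have tK : t * (8 * K + 1) <= D by rewrite -ler_pdivlMr // ge_min lexx orbT.
have ep0 : 0 < t * (D / 2) by rewrite mulr_gt0 //; lra.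
have [_ [g0 Gg0 <-] hg0] := inf_adherent ep0 hinf.
rewrite -/D in hg0.
pose u : Cvec R n := x - g0.
pose b := conj_coords u.
have hb g : G g -> complex.Re (pairing b g) < complex.Re (pairing b x).
  move=> Gg; pose d : Cvec R n := g - g0.
  have Gc : G (g0 + t%:C *: d).
    have -> : g0 + t%:C *: d = t%:C *: g + (1 - t)%:C *: g0.
      rewrite /d rmorphB rmorph1 scalerBl scalerBr scale1r addrCA; congr (_ + _).
    by apply: convex_comb => //; rewrite ltW.
  have := DS _ Gc; rewrite opprD addrA -/u cnorm_sqrB -/b => h1.
  have dK : cnorm d ^+ 2 <= 4 * K by apply: cnorm_sqr_dist; exact: hK.
  have h2 : t * (2 * complex.Re (pairing b d)) <= t * D.
    have : t ^+ 2 * cnorm d ^+ 2 <= t * (D / 2).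
      rewrite expr2 -mulrA ler_pM2l //.
      apply: le_trans (_ : t * (4 * K) <= _); first by rewrite ler_pM2l.
      by lra.
    rewrite -/u in hg0; lra.
  rewrite ler_pM2l // in h2.
  have := DS _ Gg0; rewrite -/u -pairing_conj_coords -/b => h3.
  have e1 : complex.Re (pairing b d) = complex.Re (pairing b g) -
    complex.Re (pairing b g0).
    by rewrite /d pairingB raddfB.
  have e2 : complex.Re (pairing b u) = complex.Re (pairing b x) -
    complex.Re (pairing b g0).
    by rewrite /u pairingB raddfB.
  lra.
have p0 : 0 < complex.Re (pairing b x).
  have := hb _ G0; have -> : pairing b 0 = 0; last by [].
  by rewrite /pairing big1 // => j _; rewrite mxE mulr0.
have px : pairing b x != 0.
  by apply/eqP => E; rewrite E ltxx in p0.
exists (fun j => b j / pairing b x).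
  move=> z Gz.
  have -> : pairing (fun j => b j / pairing b x) z = pairing b z / pairing b x.
    by rewrite {1 3}/pairing mulr_suml; apply: eq_bigr => j _; rewrite mulrAC.
  rewrite normcM normcV ler_pdivrMr ?normc_gt0 // mul1r.
  have [->|pz] := eqVneq (pairing b z) 0.
    by rewrite normc0 normc_ge0.
  have [c c1 cz] := eq_normc_unit pz.
  have Gcz : G (c *: z) by apply: bal => //; rewrite norm_normc c1.
  have := hb _ Gcz; rewrite pairingZ cz /= => h; apply: ltW.
  exact: lt_le_trans h (Re_le_normc _).
have -> : pairing (fun j => b j / pairing b x) x = pairing b x / pairing b x.
  by rewrite {1 3}/pairing mulr_suml; apply: eq_bigr => j _; rewrite mulrAC.
by rewrite mulfV.
Qed.
End Separation.

(** * Complex derivatives and planar differentials *)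

Section ComplexDerivative.
Variable R : realType.
Implicit Types (f g : R[i] -> R[i]) (z w a b : R[i]).

(** Complex differentiability with a quadratic error: stable under products by
algebra alone, and satisfied by every holomorphic function. *)
Definition cderiv f z a := exists C d : R, [/\ 0 <= C, 0 < d &
  forall w, normc w < d -> normc (f (z + w) - f z - a * w) <= C * normc w ^+ 2].

Lemma cderiv_cst c z : cderiv (fun=> c) z 0.
Proof.
exists 0, 1; split => // w _.
by rewrite subrr mul0r subrr normc0 mul0r.
Qed.

Lemma cderivM f g z a b : cderiv f z a -> cderiv g z b ->
  cderiv (fun z => f z * g z) z (a * g z + f z * b).
Proof.
move=> [C1 [d1 [C10 d10 h1]]] [C2 [d2 [C20 d20 h2]]].
have f0 := normc_ge0 (f z); have g0 := normc_ge0 (g z).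
have a0 := normc_ge0 a; have b0 := normc_ge0 b.
exists (normc (f z) * C2 + normc (g z) * C1 + normc a * normc b + normc a * C2 +
  normc b * C1 + C1 * C2),
  (Num.min 1 (Num.min d1 d2)).
split; [by rewrite !addr_ge0 ?mulr_ge0|by rewrite !lt_min ltr01 d10|].
move=> w; rewrite !lt_min => /and3P[w1 wd1 wd2].
have {}h1 := h1 w wd1; have {}h2 := h2 w wd2.
have w0 := normc_ge0 w.
move: h1 h2; set E1 := f (z + w) - f z - a * w;
  set E2 := g (z + w) - g z - b * w => h1 h2.
have -> : f (z + w) * g (z + w) - f z * g z - (a * g z + f z * b) * w =
  f z * E2 + g z * E1 + a * b * w ^+ 2 + a * w * E2 + b * w * E1 + E1 * E2.
  by rewrite /E1 /E2; ring.
move: E1 E2 h1 h2 => E1 E2 h1 h2.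
have W0 : 0 <= normc w ^+ 2 by exact: sqr_ge0.
have W1 : normc w ^+ 2 <= 1 by rewrite expr_le1 // ltW.
have wle (c C : R) (E : R[i]) : 0 <= c -> 0 <= C -> normc E <= C * normc w ^+ 2 ->
    c * normc w * normc E <= c * C * normc w ^+ 2.
  move=> c0 CC hE; rewrite -!mulrA ler_wpM2l //.
  apply: le_trans hE; rewrite ler_piMl ?normc_ge0 // ltW //.
rewrite !mulrDl.
apply: le_trans (le_normcD _ _) _; apply: lerD; last first.
  rewrite normcM -mulrA mulrCA;
    apply: le_trans (ler_pM (normc_ge0 _) (normc_ge0 _) h1 h2) _.
  by rewrite mulrCA mulrAC -mulrA mulrA ler_piMr ?mulr_ge0.
apply: le_trans (le_normcD _ _) _; apply: lerD; last by rewrite !normcM wle.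
apply: le_trans (le_normcD _ _) _; apply: lerD; last by rewrite !normcM wle.
apply: le_trans (le_normcD _ _) _; apply: lerD; last by rewrite !normcM.
by apply: le_trans (le_normcD _ _) _; apply: lerD; rewrite normcM -mulrA ler_wpM2l.
Qed.

Lemma cderivMl c f z a : cderiv f z a -> cderiv (fun z => c * f z) z (c * a).
Proof.
move=> h; have := cderivM (cderiv_cst c z) h.
by rewrite mul0r add0r.
Qed.

End ComplexDerivative.

Section PlanarDifferential.
Variable R : realType.

Lemma coord_linear_continuous m (a b : 'rV[R]_m) :
  continuous (fun h : 'rV[R]_2 => h ord0 ord0 *: a + h ord0 ord_max *: b).
Proof.
move=> h; have c0 : {for h, continuous (fun h : 'rV[R]_2 => h ord0 ord0)}.
  exact: coord_continuous.
have c1 : {for h, continuous (fun h : 'rV[R]_2 => h ord0 ord_max)}.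
  exact: coord_continuous.
exact: (cvgD (continuousZr_tmp (a := a) c0) (continuousZr_tmp (a := b) c1)).
Qed.

(** A linear approximation [h |-> h0 a + h1 b] gives the differential and reads off
both partial derivatives. *)
Lemma planar_diff m (f : 'rV[R]_2 -> 'rV[R]_m) (x : 'rV[R]_2) (a b : 'rV[R]_m) :
  (forall e : R, 0 < e -> exists2 d : R, 0 < d &
    forall h : 'rV[R]_2, `|h| < d ->
      `|f (x + h) - f x - (h ord0 ord0 *: a + h ord0 ord_max *: b)| <= e * `|h|) ->
  [/\ differentiable f x,
      'd f x = (fun h => h ord0 ord0 *: a + h ord0 ord_max *: b) :> ('rV[R]_2 ->
        'rV[R]_m),
      partial ord0 f x = a & partial ord_max f x = b].
Proof.
move=> hf; pose L (h : 'rV[R]_2) := h ord0 ord0 *: a + h ord0 ord_max *: b.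
have Llin : linear L.
  move=> k u v; rewrite /L !mxE scalerDr !scalerA !scalerDl addrACA.
  by [].
pose LM := GRing.isLinear.Build _ _ _ _ _ Llin.
pose L' : {linear 'rV[R]_2 -> 'rV[R]_m} := HB.pack L LM.
have cL : continuous L' by exact: coord_linear_continuous.
have [df dE] := @eps_is_diff R _ _ f x L' cL hf.
split => //.
  rewrite /partial deriveE // dE /= /L !mxE eqxx /=.
  by rewrite scale1r scale0r addr0.
rewrite /partial deriveE // dE /= /L !mxE eqxx /=.
by rewrite scale1r scale0r add0r.
Qed.

End PlanarDifferential.

(** * Holomorphic disks in a complex line *)

Lemma ord2P (i : 'I_2) : i = ord0 \/ i = ord_max.
Proof. by case: i => [[|[|//]] hi]; [left|right]; apply/val_inj. Qed.

Section HolomorphicDisks.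
Variables (R : realType) (n : nat) (e : Cvec R n).
Implicit Types (f : R[i] -> R[i]) (x h : 'rV[R]_2).

Local Notation disk := (@of_plane R @^-1` @unit_disk R).

Definition on_line (c : R[i]) : 'rV[R]_(n + n) := realify (c *: e : Cvec R n).

Lemma norm_realify (z : Cvec R n) : `|realify z| <= cnorm z.
Proof.
rewrite [leLHS]/Num.norm /= mx_normrE; apply/bigmax_leP; split=> /=.
  exact: cnorm_ge0.
move=> [i j] _ /=; rewrite (ord1 i) /realify.
case: (split_ordP j) => k ->; rewrite ?row_mxEl ?row_mxEr mxE;
  apply: le_trans (normc_coord_le z k).
- exact: abs_Re_le_normc.
- exact: abs_Im_le_normc.
Qed.

Lemma on_line_combo (A B d : R[i]) h :
  on_line A - on_line B - (h ord0 ord0 *: on_line d + h ord0 ord_max *: on_line ('i *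
    d)) =
  on_line (A - B - d * of_plane h).
Proof.
have E (M N P Q : 'rV[R]_(n + n)) (p q : R) j : (M - N - (p *: P + q *: Q)) ord0 j =
  M ord0 j - N ord0 j - (p * P ord0 j + q * Q ord0 j) by rewrite !mxE.
apply/rowP => j; rewrite E /on_line /realify.
case: (split_ordP j) => k ->; rewrite ?row_mxEl ?row_mxEr !mxE /of_plane;
  case: A B d (e ord0 k) => [a1 a2] [b1 b2] [d1 d2] [e1 e2] /=; ring.
Qed.

(** The Cauchy-Riemann equations: the two partial derivatives are again of the form
[on_line], for [f'] and for ['i * f'].  The equality with [g] is only required on
the disk so that the lemma can be iterated on partial derivatives. *)
Lemma holomorphic_partial f f' (g : 'rV[R]_2 -> 'rV[R]_(n + n)) :
  (forall z, normc z < 1 -> cderiv f z (f' z)) ->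
  (forall x, disk x -> g x = on_line (f (of_plane x))) ->
  forall x, disk x ->
  [/\ differentiable g x,
      'd g x = (fun h => h ord0 ord0 *: on_line (f' (of_plane x)) +
                         h ord0 ord_max *: on_line ('i * f' (of_plane x)))
        :> ('rV[R]_2 -> 'rV[R]_(n + n)),
      partial ord0 g x = on_line (f' (of_plane x)) &
      partial ord_max g x = on_line ('i * f' (of_plane x))].
Proof.
move=> hf hg x xD; apply: planar_diff => ep ep0.
have /unit_diskE x1 := xD.
have [C [d [C0 d0 hd]]] := hf _ x1.
pose K := 4 * C * cnorm e + 1.
have ce0 := cnorm_ge0 e.
have K0 : 0 < K by rewrite /K ltr_pwDr // mulr_ge0 // mulr_ge0.
exists (Num.min (d / 2) (Num.min ((1 - normc (of_plane x)) / 2) (ep / K))).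
  by rewrite !lt_min !divr_gt0 ?subr_gt0.
move=> h; rewrite !lt_min => /and3P[h1 h2 h3].
have nh := normc_of_plane h.
have xh : of_plane (x + h) = of_plane x + of_plane h :> R[i].
  by apply/eqP; rewrite eq_complex /= !mxE !eqxx.
have xhD : disk (x + h).
  apply/unit_diskE; rewrite xh; apply: le_lt_trans (le_normcD _ _) _.
  by rewrite ltr_pdivlMr // in h2; lra.
rewrite (hg _ xD) (hg _ xhD) xh on_line_combo.
apply: le_trans (norm_realify _) _; rewrite cnormZ.
have hdw : normc (of_plane h) < d by rewrite ltr_pdivlMr // in h1; lra.
apply: le_trans (ler_wpM2r ce0 (hd _ hdw)) _.
have hn0 := normr_ge0 h.
have sq : normc (of_plane h) ^+ 2 <= 4 * (`|h| * `|h|).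
  rewrite (_ : 4 * _ = (2 * `|h|) ^+ 2); last by ring.
  by rewrite ler_pXn2r ?nnegrE ?normc_ge0 ?mulr_ge0.
have Kh : `|h| * K <= ep by rewrite -ler_pdivlMr ?ltW.
apply: le_trans (_ : `|h| * (4 * C * cnorm e) * `|h| <= _).
  have -> : `|h| * (4 * C * cnorm e) * `|h| = C * (4 * (`|h| * `|h|)) * cnorm e by ring.
  by rewrite ler_wpM2r // ler_wpM2l.
rewrite ler_wpM2r //; apply: le_trans Kh; rewrite ler_wpM2l // /K; lra.
Qed.

Lemma holomorphic_C1 f f1 f2 (g : 'rV[R]_2 -> 'rV[R]_(n + n)) :
  (forall z, normc z < 1 -> cderiv f z (f1 z)) ->
  (forall z, normc z < 1 -> cderiv f1 z (f2 z)) ->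
  (forall x, disk x -> g x = on_line (f (of_plane x))) -> C1_on disk g.
Proof.
move=> hf hf1 hg x xD.
have [dg _ _ _] := holomorphic_partial hf hg xD; split => //.
have h0 y : disk y -> partial ord0 g y = on_line (f1 (of_plane y)).
  by move=> yD; have [] := holomorphic_partial hf hg yD.
have h1 y : disk y -> partial ord_max g y = on_line ('i * f1 (of_plane y)).
  by move=> yD; have [] := holomorphic_partial hf hg yD.
have c0 : {for x, continuous (partial ord0 g)}.
  apply: differentiable_continuous.
  by have [] := holomorphic_partial hf1 h0 xD.
have c1 : {for x, continuous (partial ord_max g)}.
  apply: differentiable_continuous.
  have hif z : normc z < 1 -> cderiv (fun z => 'i * f1 z) z ('i * f2 z).
    by move=> z1; apply: cderivMl; exact: hf1.
  by have [] := holomorphic_partial hif h1 xD.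
by move=> i; case: (ord2P i) => ->; [exact: c0|exact: c1].
Qed.

(** The second pure derivatives are [f2] and ['i * ('i * f2)], which cancel. *)
Lemma holomorphic_harmonic f f1 f2 f3 :
  (forall z, normc z < 1 -> cderiv f z (f1 z)) ->
  (forall z, normc z < 1 -> cderiv f1 z (f2 z)) ->
  (forall z, normc z < 1 -> cderiv f2 z (f3 z)) ->
  harmonic_map (fun z => f z *: e : Cvec R n).
Proof.
move=> hf hf1 hf2; set F := (fun z => _).
have hg x : disk x -> real_form F x = on_line (f (of_plane x)) by [].
have hi (p q : R[i] -> R[i]) : (forall z, normc z < 1 -> cderiv p z (q z)) ->
    forall z, normc z < 1 -> cderiv (fun z => 'i * p z) z ('i * q z).
  by move=> hpq z z1; apply: cderivMl; exact: hpq.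
have h0 y : disk y -> partial ord0 (real_form F) y = on_line (f1 (of_plane y)).
  by move=> yD; have [] := holomorphic_partial hf hg yD.
have h1 y : disk y -> partial ord_max (real_form F) y = on_line ('i * f1 (of_plane y)).
  by move=> yD; have [] := holomorphic_partial hf hg yD.
split.
  split; first exact: (holomorphic_C1 hf hf1 hg).
  move=> i; case: (ord2P i) => ->; first exact: (holomorphic_C1 hf1 hf2 h0).
  exact: (holomorphic_C1 (hi _ _ hf1) (hi _ _ hf2) h1).
move=> u uD; rewrite /laplacian sum_ord2.
have [_ _ -> _] := holomorphic_partial hf1 h0 uD.
have [_ _ _ ->] := holomorphic_partial (hi _ _ hf1) h1 uD.
apply/rowP => j; rewrite [LHS]mxE /on_line /realify.
case: (split_ordP j) => k ->; rewrite ?row_mxEl ?row_mxEr !mxE;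
  case: (f2 _) (e ord0 k) => [d1 d2] [e1 e2] /=; ring.
Qed.

Lemma holomorphic_dF0 f f' : (forall z, normc z < 1 -> cderiv f z (f' z)) ->
  dF0 (fun z => f z *: e : Cvec R n) = (fun u => (f' 0 * of_plane u) *: e).
Proof.
move=> hf; set F := (fun z => _).
have hg x : disk x -> real_form F x = on_line (f (of_plane x)) by [].
have D0 : disk 0 by apply/unit_diskE; rewrite of_plane0 normc0.
have [_ dE _ _] := holomorphic_partial hf hg D0.
apply/funext => u; rewrite /dF0 dE of_plane0 /on_line /unrealify /realify.
apply/rowP => j; rewrite [LHS]mxE.
have E (P Q : 'rV[R]_(n + n)) (p q : R) k : (p *: P + q *: Q) ord0 k =
  p * P ord0 k + q * Q ord0 k by rewrite !mxE.
rewrite [lsubmx _ _ _]mxE [rsubmx _ _ _]mxE !E !row_mxEl !row_mxEr !mxE /of_plane.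
case: (f' 0) (e ord0 j) => [d1 d2] [e1 e2] /=; apply/eqP; rewrite eq_complex /=.
by apply/andP; split; apply/eqP; ring.
Qed.
End HolomorphicDisks.

(** * The Moebius disk *)

Section Mobius.
Variables (R : realType) (r s : R).
Hypotheses (r0 : 0 < r) (s0 : 0 <= s) (s1 : s < 1).
Implicit Types z w : R[i].

Definition denom_inv z : R[i] := (1 + s%:C * z)^-1.
Definition mobius z : R[i] := r%:C * (s%:C + z) / (1 + s%:C * z).

Lemma denom_ge z : normc z < 1 -> 1 - s <= normc (1 + s%:C * z).
Proof.
move=> z1; have : normc 1 <= normc (1 + s%:C * z) + normc (s%:C * z).
  rewrite -[normc (s%:C * z)]normcN; apply: le_trans (le_normcD _ _).
  by rewrite addrK.
rewrite normc1 normcM normc_real ger0_norm //.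
have : s * normc z <= s by rewrite ler_piMr // ltW.
lra.
Qed.

Lemma denom_neq0 z : normc z < 1 -> 1 + s%:C * z != 0.
Proof.
by move=> /denom_ge h; rewrite -normc_gt0; apply: lt_le_trans h; rewrite subr_gt0.
Qed.

(** The remainder is exactly [s^2 q(z)^2 q(z + w) w^2] for [q = denom_inv], and [q] is
bounded by [1 / (1 - s)] on the disk. *)
Lemma cderiv_denom_inv z : normc z < 1 -> cderiv denom_inv z (- s%:C * denom_inv z ^+ 2).
Proof.
move=> z1; have d0 : 0 < 1 - s by rewrite subr_gt0.
exists (s ^+ 2 * (1 - s)^-1 ^+ 3), (1 - normc z); split.
- by rewrite mulr_ge0 ?sqr_ge0 ?exprn_ge0 // invr_ge0 ltW.
- by rewrite subr_gt0.
move=> w w1; have zw1 : normc (z + w) < 1.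
  by apply: le_lt_trans (le_normcD _ _) _; rewrite addrC -ltrBrDr.
have -> : denom_inv (z + w) - denom_inv z - (- s%:C * denom_inv z ^+ 2) * w =
   s%:C ^+ 2 * (denom_inv z ^+ 2 * denom_inv (z + w)) * w ^+ 2.
  by rewrite /denom_inv; field; rewrite !denom_neq0.
have qle y : normc y < 1 -> normc (denom_inv y) <= (1 - s)^-1.
  by move=> y1; rewrite normcV lef_pV2 ?posrE ?denom_ge // normc_gt0 denom_neq0.
rewrite normcM [normc (w ^+ 2)]normcX ler_wpM2r ?sqr_ge0 //.
rewrite normcM normcX normc_real (ger0_norm s0) normcM normcX.
rewrite ler_wpM2l ?sqr_ge0 // [_ ^+ 3]exprSr; apply: ler_pM;
  rewrite ?exprn_ge0 ?normc_ge0 ?qle //.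
by rewrite ler_pXn2r ?nnegrE ?normc_ge0 ?qle // invr_ge0 ltW.
Qed.

Let k : R[i] := r%:C * (1 - s%:C ^+ 2).
(** The successive derivatives of [mobius]; by
[(1 + s z) - s (s + z) = 1 - s^2] the first is a multiple of [denom_inv]
squared. *)
Definition mobius1 z := k * (denom_inv z * denom_inv z).
Definition mobius2 z := - 2 * s%:C * k * (denom_inv z * denom_inv z * denom_inv z).
Definition mobius3 z := 6 * s%:C ^+ 2 * k * (denom_inv z * denom_inv z *
  denom_inv z * denom_inv z).

Lemma cderiv_eq (f g : R[i] -> R[i]) z a b : f =1 g -> a = b -> cderiv f z a ->
  cderiv g z b.
Proof. by move=> /funext -> ->. Qed.

Lemma cderiv_mobius z : normc z < 1 -> cderiv mobius z (mobius1 z).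
Proof.
move=> z1.
have id_s : cderiv (fun z => s%:C + z) z 1.
  exists 0, 1; split => // w _.
  by rewrite (_ : s%:C + (z + w) - (s%:C + z) - 1 * w = 0) ?normc0 ?mul0r //; ring.
have h := cderivMl r%:C (cderivM id_s (cderiv_denom_inv z1)).
apply: cderiv_eq h; first by move=> y; rewrite /mobius mulrA.
rewrite /mobius1 /k /denom_inv; field; exact: denom_neq0.
Qed.

Lemma cderiv_mobius1 z : normc z < 1 -> cderiv mobius1 z (mobius2 z).
Proof.
move=> z1; have h := cderiv_denom_inv z1.
apply: cderiv_eq (cderivMl k (cderivM h h)) => //.
by rewrite /mobius2; ring.
Qed.

Lemma cderiv_mobius2 z : normc z < 1 -> cderiv mobius2 z (mobius3 z).
Proof.
move=> z1; have h := cderiv_denom_inv z1.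
apply: cderiv_eq (cderivMl (- 2 * s%:C * k) (cderivM (cderivM h h) h)) => //.
by rewrite /mobius3; ring.
Qed.

Lemma mobius_lt z : normc z < 1 -> normc (mobius z) < r.
Proof.
move=> z1; have dz := denom_neq0 z1.
rewrite /mobius !normcM normcV normc_real gtr0_norm // -mulrA gtr_pMr //.
rewrite ltr_pdivrMr ?normc_gt0 // mul1r -(@ltr_pXn2r _ 2) ?nnegrE ?normc_ge0 //.
rewrite -subr_gt0.
have -> : normc (1 + s%:C * z) ^+ 2 - normc (s%:C + z) ^+ 2 = (1 - s ^+ 2) * (1 -
  normc z ^+ 2).
  by rewrite !normc_sqr; case: (z) => a b /=; ring.
by rewrite mulr_gt0 // subr_gt0 expr_lt1 ?normc_ge0.
Qed.

Lemma mobius1_0 : mobius1 0 = (r * (1 - s ^+ 2))%:C.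
Proof.
rewrite /mobius1 /denom_inv mulr0 addr0 invr1 !mulr1 /k.
by rewrite ofrealM rmorphB rmorph1 rmorphXn.
Qed.

Lemma mobius_harmonic n (e : Cvec R n) : harmonic_map (mobius_disk r s e).
Proof.
exact: (holomorphic_harmonic e cderiv_mobius cderiv_mobius1 cderiv_mobius2).
Qed.

Lemma mobius_dF0 n (e : Cvec R n) :
  dF0 (mobius_disk r s e) = (fun u => ((r * (1 - s ^+ 2))%:C * of_plane u) *: e).
Proof. by rewrite -mobius1_0 -(holomorphic_dF0 e cderiv_mobius). Qed.

End Mobius.

Section ConformalNorm.
Variables (R : realType) (n : nat).

Lemma opnorm_conformal (L : 'rV[R]_2 -> Cvec R n) (l : R) : 0 < l ->
  (forall u, cnorm (L u) = l * enorm u) -> opnorm L = l.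
Proof.
move=> l0 hL; rewrite /opnorm; set S := [set _ | _ in _].
have e1 : enorm (plane (1 : R[i])) = 1 by rewrite enorm_plane normc1.
have Sl : S l by exists (plane 1); rewrite /= ?e1 // hL e1 mulr1.
have ub : ubound S l.
  move=> _ [u /= u1 <-]; rewrite hL ler_piMr // ltW //.
apply/eqP; rewrite eq_le; apply/andP; split; first by apply: ge_sup => //; exists l.
by apply: ub_le_sup => //; exists l.
Qed.

End ConformalNorm.

(** * The extremal problem *)

Section Extremal.
Variables (R : realType) (n : nat).
Implicit Types (v e : Cvec R n) (G : set (Cvec R n)).

Lemma eq_complex_line v e : complex_line v e -> cnorm e = 1 ->
  complex_line e = complex_line v.
Proof.
case=> c _ <- {e} c1.
have c0 : c != 0.
  apply/eqP => E; move: c1; rewrite E cnormZ normc0 mul0r => /eqP.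
  by rewrite eq_sym oner_eq0.
apply/seteqP; split => w [d _ <-].
  by exists (d * c) => //; rewrite scalerA.
by exists (d / c) => //; rewrite scalerA divfK.
Qed.

Lemma mobius_admissible G v (r : R) p e : cnorm v = 1 -> 0 < r ->
  (forall c : R[i], normc c < r -> G (c *: v)) ->
  cnorm p < r -> complex_line v e -> cnorm e = 1 -> p = ((cnorm p)%:C : Cplx R) *: e ->
  harmonic_disks G p (complex_line v) (mobius_disk r (cnorm p / r) e) /\
  opnorm (dF0 (mobius_disk r (cnorm p / r) e)) = (r ^+ 2 - cnorm p ^+ 2) / r.
Proof.
move=> v1 r0 hG pr ev e1 pe.
set s := cnorm p / r.
have p0 := cnorm_ge0 p.
have s0 : 0 <= s by rewrite divr_ge0 // ltW.
have s1 : s < 1 by rewrite ltr_pdivrMr // mul1r.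
have lE : (r ^+ 2 - cnorm p ^+ 2) / r = r * (1 - s ^+ 2).
  by rewrite /s; field; exact: lt0r_neq0.
set l := _ / r in lE *.
have l0 : 0 < l by rewrite lE mulr_gt0 // subr_gt0 expr_lt1.
have dF := mobius_dF0 r s0 s1 e; rewrite -lE in dF.
have conf u : cnorm (dF0 (mobius_disk r s e) u) = l * enorm u.
  rewrite dF cnormZ e1 mulr1 normcM normc_real gtr0_norm //.
  by rewrite -[in RHS](of_planeK u) enorm_plane.
split; last exact: opnorm_conformal.
split; split.
- exact: mobius_harmonic.
- move=> z zD; have z1 : normc z < 1 by apply/unit_diskE.
  have [c _ cE] := ev.
  have c1 : normc c = 1 by have := cnormZ c v; rewrite cE e1 v1 mulr1.
  have -> : mobius_disk r s e z = (mobius r s z * c) *: v by rewrite -scalerA cE.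
  by apply: hG; rewrite normcM c1 mulr1; exact: mobius_lt.
- rewrite /mobius_disk mulr0 !addr0 divr1 [RHS]pe; congr (_ *: _).
  by rewrite -ofrealM /s mulrC divfK // lt0r_neq0.
- move=> E; have := conf (plane 1); rewrite E enorm_plane normc1 mulr1.
  have -> : cnorm (0 : Cvec R n) = 0.
    have := cnormZ 0 (0 : Cvec R n); by rewrite scale0r normc0 mul0r.
  by move=> E'; move: l0; rewrite -E' ltxx.
- by exists l.
- rewrite -(eq_complex_line ev e1) dF; apply/seteqP; split => w [].
    by move=> u _ <-; exists (l%:C * of_plane u).
  move=> c _ <-; exists (plane (l%:C^-1 * c)) => //; rewrite planeK mulrA divff ?mul1r //.
  by rewrite -normc_gt0 normc_real gtr0_norm.
Qed.

(** The bound of [stretch_bound] for all [q = r + ep], in the form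
[l r <= r^2 - |p|^2 + O(ep)]. *)
Lemma harmonic_disk_stretch_le G v (r : R) p F : open G -> bounded_set G -> balanced G ->
  convex_set G -> G 0 -> cnorm v = 1 -> 0 < r -> ~ G (r%:C *: v) ->
  complex_line v p -> harmonic_disks G p (complex_line v) F ->
  opnorm (dF0 F) <= (r ^+ 2 - cnorm p ^+ 2) / r.
Proof.
move=> oG bdG bal cG G0 v1 r0 Grv [c0 _ pE] [[hF FG F0] [_ [l l0 hl] hr]].
rewrite (opnorm_conformal l0 hl).
have np : cnorm p = normc c0 by rewrite -pE cnormZ v1 mulr1.
have key ep : 0 < ep -> l * r <= r ^+ 2 - cnorm p ^+ 2 + (2 * r * ep + ep ^+ 2).
  move=> ep0; have q1 : 1 < (r + ep) / r by rewrite ltr_pdivlMr // mul1r ltrDl.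
  have [b hb bv] := separation oG bdG bal cG G0 Grv q1.
  have bv' : (r + ep)%:C * pairing b v = 1.
    by rewrite -bv scalerA -ofrealM divfK ?lt0r_neq0 // pairingZ.
  have q0 : 0 < r + ep by rewrite addr_gt0.
  have := stretch_bound hF FG (etrans F0 (esym pE)) l0 hl hr v1 q0 hb bv'.
  rewrite ler_pdivlMr // np.
  have : 0 < l * ep by rewrite mulr_gt0.
  lra.
rewrite ler_pdivlMr //; apply/ler_addgt0Pr => ep ep0.
pose dl := Num.min 1 (ep / (2 * r + 1)).
have k0 : 0 < 2 * r + 1 by lra.
have dl0 : 0 < dl by rewrite lt_min ltr01 divr_gt0.
have dl1 : dl <= 1 by rewrite ge_min lexx.
have dlk : dl * (2 * r + 1) <= ep by rewrite -ler_pdivlMr // ge_min lexx orbT.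
apply: le_trans (key _ dl0) _; rewrite lerD2l.
have : dl ^+ 2 <= dl by rewrite expr2 ler_piMl // ltW.
lra.
Qed.

End Extremal.

(** * The theorem *)

Theorem theorem4p12 (R : realType) (n : nat) (G : set (Cvec R n))
  (G_dom : domain G) (G_bnd : bounded_set G) (G_bal : balanced G)
  (G_cvx : convex_set G) (G_0 : G 0)
  (v : Cvec R n) (v_unit : cnorm v = 1)
  (r : R) (r_gt0 : 0 < r)
  (slice : G `&` complex_line v =
           [set (c : Cplx R) *: v | c in [set c : Cplx R | `|c| < r%:C]])
  (p : Cvec R n) (Gp : (G `&` complex_line v) p) :
  maximal_stretch G p (complex_line v) = ((r ^+ 2 - cnorm p ^+ 2) / r)%:E /\
  forall e : Cvec R n, complex_line v e -> cnorm e = 1 ->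
    p = ((cnorm p)%:C : Cplx R) *: e ->
    directional_extremal G p (complex_line v) (mobius_disk r (cnorm p / r) e).
Proof.
have [oG _ _] := G_dom.
have pL : complex_line v p by have [] := Gp.
have inG (c : R[i]) : normc c < r -> G (c *: v).
  move=> cr; suff [] : (G `&` complex_line v) (c *: v) by [].
  by rewrite slice; exists c => //=; rewrite norm_normc ltcR.
have inG' (c : R[i]) : G (c *: v) -> normc c < r.
  move=> Gc; have : (G `&` complex_line v) (c *: v) by split => //; exists c.
  rewrite slice => -[d /=]; rewrite norm_normc ltcR => dr E.
  have -> : normc c = normc d by rewrite -[LHS]mulr1 -[RHS]mulr1 -v_unit -!cnormZ E.
  exact: dr.
have Grv : ~ G (r%:C *: v).
  by move=> /inG'; rewrite normc_real gtr0_norm // ltxx.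
have [c0 _ pE] := pL.
have np : cnorm p = normc c0 by rewrite -pE cnormZ v_unit mulr1.
have pr : cnorm p < r by rewrite np; apply: inG'; rewrite pE; case: Gp.
have mob e := @mobius_admissible R n G v r p e v_unit r_gt0 inG pr.
have max_eq e : complex_line v e -> cnorm e = 1 -> p = ((cnorm p)%:C : Cplx R) *: e ->
    maximal_stretch G p (complex_line v) = ((r ^+ 2 - cnorm p ^+ 2) / r)%:E.
  move=> ev e1 pe; have [hD hO] := mob e ev e1 pe.
  apply/eqP; rewrite eq_le; apply/andP; split.
    apply: ge_ereal_sup => _ [F hF <-]; rewrite lee_fin.
    exact: (harmonic_disk_stretch_le oG G_bnd G_bal G_cvx G_0 v_unit r_gt0 Grv pL hF).
  by apply: ereal_sup_ubound; exists (mobius_disk r (cnorm p / r) e); rewrite ?hO.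
split; last first.
  move=> e ev e1 pe; have [hD hO] := mob e ev e1 pe; split => //.
  by rewrite (max_eq e) // hO.
have [c00|c00] := eqVneq c0 0.
  apply: (max_eq v) => //; first by exists 1 => //; rewrite scale1r.
  by rewrite np -pE c00 normc0 !scale0r.
have [u u1 uc] := eq_normc_unit c00.
have u0 : u != 0 by rewrite -normc_gt0 u1.
apply: (max_eq (u^-1 *: v)).
- by exists u^-1.
- by rewrite cnormZ normcV u1 invr1 mul1r.
- by rewrite np -uc scalerA [u * c0]mulrC mulfK // pE.
Qed.
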